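(* Let $\mathbb{D}$ be a division ring and $M\ge4$. The B-quadrilateral lattice constraint is multidimensionally consistent in $\mathbb{P}^M(\mathbb{D})$ if and only if $\mathbb{D}$ is commutative. Explicitly, the following are equivalent: (i) for every generic hypercube with planar faces in $\mathbb{P}^M(\mathbb{D})$ whose four initial hexahedra satisfy the B-constraint (i.e. $x_0,x_{ij},x_{ik},x_{jk}$ are coplanar for all distinct $i,j,k\in\{1,2,3,4\}$), the four final hexahedra satisfy the B-constraint as well (i.e. $x_i,x_{ijk},x_{ijl},x_{ikl}$ are coplanar for all $i$, where $\{i,j,k,l\}=\{1,2,3,4\}$); (ii) $\mathbb{D}$ is commutative.
   Context: $\mathbb{P}^M(\mathbb{D})$ is the $M$-dimensional right projective space over the division ring $\mathbb{D}$ (points are one-dimensional subspaces of the right vector space $\mathbb{D}^{M+1}$); $\langle\cdots\rangle$ denotes the projective subspace spanned by the given points. Indices of $x_{ij}$, $x_{ijk}$, $x_{1234}$ are unordered. B-constraint: a quadrilateral lattice $x:\mathbb{Z}^N\to\mathbb{P}^M$ (i.e. a map with all elementary quadrilaterals $x,T_ix,T_jx,T_iT_jx$ planar, $T_i$ being the shift in the $i$-th direction) is a B-quadrilateral lattice if for all distinct $i,j,k$ the points $x$, $T_iT_jx$, $T_iT_kx$, $T_jT_kx$ are coplanar. The constraint is imposed on each elementary hexahedron, and its multidimensional consistency means compatibility with the four dimensional consistency of the construction of planar-faced hypercubes, as in (i). Generic hypercube with planar faces: points $x_0,x_1,x_2,x_3,x_4$ in general position in $\mathbb{P}^M$ (spanning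 a four dimensional subspace); points $x_{ij}\in\langle x_0,x_i,x_j\rangle$, $1\le i<j\le4$, not on the lines $\langle x_0,x_i\rangle$, $\langle x_0,x_j\rangle$, $\langle x_i,x_j\rangle$; for $i<j<k$ the point $x_{ijk}$ is the unique common point of the planes $\langle x_i,x_{ij},x_{ik}\rangle$, $\langle x_j,x_{ij},x_{jk}\rangle$, $\langle x_k,x_{ik},x_{jk}\rangle$; and $x_{1234}$ is the unique common point of the four three dimensional subspaces $\langle x_1,x_{12},x_{13},x_{14}\rangle$, $\langle x_2,x_{12},x_{23},x_{24}\rangle$, $\langle x_3,x_{13},x_{23},x_{34}\rangle$, $\langle x_4,x_{14},x_{24},x_{34}\rangle$. Generality of the configuration is assumed: only the stated incidences and their consequences hold; in particular these intersections are single points, and $\langle x_0,x_1,x_2,x_3,x_4\rangle=\langle x_{1234},x_{123},x_{124},x_{134},x_{234}\rangle$ has dimension four. The generality conditions required are those listed here. The four initial hexahedra are those sharing the vertex $x_0$ (vertices $x_0,x_i,x_j,x_k,x_{ij},x_{ik},x_{jk},x_{ijk}$); the four final hexahedra are those sharing the vertex $x_{1234}$ (vertices $x_i,x_{ij},x_{ik},x_{il},x_{ijk},x_{ijl},x_{ikl},x_{1234}$). *)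

(* Defs.v *)
From mathcomp Require Import all_boot all_algebra.
From mathcomp Require Import all_classical.

Set Implicit Arguments.
Unset Strict Implicit.
Unset Printing Implicit Defensive.

Import GRing.Theory.
Local Open Scope ring_scope.
Local Open Scope classical_set_scope.

(* GRing.field_axiom says that every nonzero element is invertible; over a
   unitRingType, whose multiplication need not commute and in which 1 != 0,
   this is exactly a division ring. *)
Definition division_ring (D : unitRingType) : Prop := GRing.field_axiom D.

(* Column vectors form the right D-vector space D^n: the scalar a acts on v by
   v *m a%:M, and B *m c is the right linear combination of the columns of B
   with coefficients c. *)
Definition right_subspace (D : unitRingType) (n : nat) (W : set 'cV[D]_n) :
    Prop :=
  [/\ W 0,
      forall u v, W u -> W v -> W (u + v)
    & forall v (a : D), W v -> W (v *m a%:M)].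

(* The columns of B form a basis of W. *)
Definition is_basis (D : unitRingType) (n d : nat) (B : 'M[D]_(n, d))
    (W : set 'cV[D]_n) : Prop :=
  injective (mulmx B : 'cV[D]_d -> 'cV[D]_n)
  /\ W = range (mulmx B : 'cV[D]_d -> 'cV[D]_n).

Definition has_dim (D : unitRingType) (n d : nat) (W : set 'cV[D]_n) : Prop :=
  exists B : 'M[D]_(n, d), is_basis B W.

Record proj_point (D : unitRingType) (M : nat) : Type := ProjPoint {
  point_carrier :> set 'cV[D]_M.+1;
  point_dim : has_dim 1 point_carrier }.

(* Projective subspaces are represented by the underlying vector subspaces, so
   that incidence is inclusion and the dimension is shifted by one. *)
Definition proj_dim (D : unitRingType) (M d : nat) (W : set 'cV[D]_M.+1) :
    Prop :=
  has_dim d.+1 W.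

Definition lies_on (D : unitRingType) (M : nat) (p : proj_point D M)
    (W : set 'cV[D]_M.+1) : Prop :=
  p `<=` W.

Definition proj_span (D : unitRingType) (M : nat) (X : set (proj_point D M)) :
    set 'cV[D]_M.+1 :=
  smallest (@right_subspace D M.+1) (\bigcup_(p in X) p).

Definition coplanar (D : unitRingType) (M : nat) (X : set (proj_point D M)) :
    Prop :=
  exists W : set 'cV[D]_M.+1,
    proj_dim 2 W /\ forall p, X p -> lies_on p W.

Definition unique_common_point (D : unitRingType) (M : nat)
    (F : set (set 'cV[D]_M.+1)) (p : proj_point D M) : Prop :=
  [set q : proj_point D M | forall W, F W -> lies_on q W] = [set p].

(* The vertices of a hypercube are indexed by the finite subsets of 'I_4
   (the directions 1, 2, 3, 4 being 0, 1, 2, 3 here): x_0, x_i, x_ij, x_ijk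
   and x_1234 are the values of x at the sets of their indices. *)
Local Notation V0 := (@finset.set0 _).
Local Notation V1 i := (finset.set1 i).
Local Notation V2 i j := (finset.setU (V1 i) (V1 j)).
Local Notation V3 i j k := (finset.setU (V2 i j) (V1 k)).
Local Notation V1234 := (finset.setTfor 'I_4).

Record generic_hypercube (D : unitRingType) (M : nat)
    (x : {set 'I_4} -> proj_point D M) : Prop := GenericHypercube {
  general_position :
    proj_dim 4 (proj_span (x V0 |` [set x (V1 i) | i in setT]));
  vertex2_plane : forall i j, i != j ->
    lies_on (x (V2 i j)) (proj_span [set x V0; x (V1 i); x (V1 j)]);
  (* exchanging i and j gives the line through x_0 and x_j *)
  vertex2_line0 : forall i j, i != j ->
    ~ lies_on (x (V2 i j)) (proj_span [set x V0; x (V1 i)]);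
  vertex2_line : forall i j, i != j ->
    ~ lies_on (x (V2 i j)) (proj_span [set x (V1 i); x (V1 j)]);
  vertex3 : forall i j k, uniq [:: i; j; k] ->
    unique_common_point
      [set proj_span [set x (V1 i); x (V2 i j); x (V2 i k)];
           proj_span [set x (V1 j); x (V2 i j); x (V2 j k)];
           proj_span [set x (V1 k); x (V2 i k); x (V2 j k)]]
      (x (V3 i j k));
  vertex4 :
    unique_common_point
      [set proj_span (x (V1 i) |` [set x (V2 i j) | j in [set j | j != i]])
         | i in setT]
      (x V1234);
  span_vertices :
    proj_span (x V0 |` [set x (V1 i) | i in setT])
    = proj_span (x V1234 |` [set x (finset.setC (V1 i)) | i in setT]) }.

(* The constraint on the elementary hexahedron with vertex x_S and edges in the
   directions i, j, k: with y := x_S, the points y, T_i T_j y, T_i T_k y and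
   T_j T_k y are coplanar. *)
Definition B_constraint (D : unitRingType) (M : nat)
    (x : {set 'I_4} -> proj_point D M) (S : {set 'I_4}) (i j k : 'I_4) : Prop :=
  coplanar [set x S; x (finset.setU S (V2 i j));
                x (finset.setU S (V2 i k)); x (finset.setU S (V2 j k))].

Definition initial_B (D : unitRingType) (M : nat)
    (x : {set 'I_4} -> proj_point D M) : Prop :=
  forall i j k, uniq [:: i; j; k] -> B_constraint x V0 i j k.

(* The final hexahedron with vertices x_i, ..., x_1234 has directions j, k, l. *)
Definition final_B (D : unitRingType) (M : nat)
    (x : {set 'I_4} -> proj_point D M) : Prop :=
  forall i j k l, uniq [:: i; j; k; l] -> B_constraint x (V1 i) j k l.

Definition B_consistent (D : unitRingType) (M : nat) : Prop :=
  forall x : {set 'I_4} -> proj_point D M,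
    generic_hypercube x -> initial_B x -> final_B x.

(* Main.v *)
Require Import Defs.
From mathcomp Require Import all_boot all_algebra.
From mathcomp Require Import all_classical.
From Stdlib Require Ncring Ncring_tac.

(* Over any division ring the initial B-constraints allow lifts e_0, e_1, ..., e_4
   of x_0, x_1, ..., x_4 such that x_ij = [e_0 f_ij + e_i - e_j] with f
   antisymmetric and nowhere zero. In homogeneous coordinates (w_0; w_1, ..., w_4)
   the plane <x_i, x_ij, x_ik> of the span of x_0, x_i, x_j, x_k has equation
   w_0 + f_ij w_j + f_ik w_k = 0. With g = f_ij + f_jk + f_ki, which genericity
   makes nonzero, x_ijk has w_i : w_j : w_k = g^-1 f_jk : g^-1 f_ki : g^-1 f_ij and
   w_0 = f_ik g^-1 f_ij - f_ij g^-1 f_ik. If D is commutative, then w_0 = 0, so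
   that x_i, x_ijk, x_ijl, x_ikl all lie on the plane w_0 = 0,
   f_ij w_j + f_ik w_k + f_il w_l = 0. If a b != b a, then
   f_12 = f_14 = f_24 = 1, f_13 = f_23 = a, f_34 = b + 1 - a is a generic
   hypercube whose final constraint at x_1 fails. *)

Set Implicit Arguments.
Unset Strict Implicit.
Unset Printing Implicit Defensive.

Import GRing.Theory.
Local Open Scope ring_scope.
Local Open Scope classical_set_scope.

(** The lifts come from a rescaling. A B-constraint says that modulo x_0 the points x_ij, x_ik, x_jk
    become collinear, just as e_i - e_j, e_i - e_k, e_j - e_k are. Scaling e_2, e_3, e_4 to suit
    x_12, x_13, x_14 lets the three constraints involving direction 1 settle the remaining x_jk. The
    constants of the counterexample send exactly one of x_123, x_124, x_134 off the hyperplane w_0 =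
    0. For {1,2,3} and {1,2,4} the values of f commute and g = 1, so w_0 = 0; f_34 is solved from
    f_13 + f_34 - f_14 = b, so that w_0 of x_134 is, up to sign, the commutator of a and b^-1. Then
    x_1, x_123, x_124 span a plane inside w_0 = 0, which misses x_134. *)

#[local] Instance ncring_ops (D : unitRingType) :
  @Ncring.Ring_ops D 0 1 +%R *%R (fun x y => x - y) -%R eq := {}.

#[local] Instance ncring_ring (D : unitRingType) :
  @Ncring.Ring D 0 1 +%R *%R (fun x y => x - y) -%R eq (ncring_ops D).
Proof.
constructor.
- by split; [by [] | by move=> ? ? -> | by move=> ? ? ? -> ->].
- by move=> ? ? -> ? ? ->.
- by move=> ? ? -> ? ? ->.
- by move=> ? ? -> ? ? ->.
- by move=> ? ? ->.
- exact: add0r.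
- exact: addrC.
- exact: addrA.
- exact: mul1r.
- exact: mulr1.
- exact: mulrA.
- exact: mulrDl.
- by move=> x y z; exact: mulrDr.
- by [].
- exact: subrr.
Qed.

Ltac ncring := Ncring_tac.non_commutative_ring.

(** * Linear algebra over a division ring *)

Lemma divring_mul_eq0 (D : unitRingType) : division_ring D ->
  forall a b : D, a * b = 0 -> a = 0 \/ b = 0.
Proof.
move=> hD a b ab0; have [->|a0] := eqVneq a 0; first by left.
by right; rewrite -[b](mulKr (hD _ a0)) ab0 mulr0.
Qed.

Lemma divring_mul_neq0 (D : unitRingType) : division_ring D ->
  forall a b : D, a != 0 -> b != 0 -> a * b != 0.
Proof.
move=> hD a b a0 b0; apply/eqP => /(divring_mul_eq0 hD) [] /eqP.
  by rewrite (negPf a0).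
by rewrite (negPf b0).
Qed.

Lemma cV_neq0P (D : unitRingType) n (v : 'cV[D]_n) :
  reflect (exists i, v i 0 != 0) (v != 0).
Proof.
apply: (iffP idP) => [v0|[i vi]]; last first.
  by apply: contra_neq vi => ->; rewrite mxE.
apply/existsP; apply: contraNT v0; rewrite negb_exists => /forallP h.
apply/eqP/matrixP => i j; rewrite ord1 mxE.
by apply/eqP; move: (h i); rewrite negbK.
Qed.

(* Gaussian elimination on the first row, valid without commutativity. *)
Lemma wide_mx_kernel (D : unitRingType) (m n : nat) (A : 'M[D]_(m, n)) :
  division_ring D -> (m < n)%N -> exists2 v : 'cV[D]_n, v != 0 & A *m v = 0.
Proof.
move=> hD; elim: m n A => [|m IH] [//|n] A mn.
  exists (const_mx 1); last by apply/matrixP => -[].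
  by apply/cV_neq0P; exists 0; rewrite mxE oner_neq0.
have rowE (v : 'cV[D]_n.+1) i : (A *m v) i 0 = \sum_j A i j * v j 0.
  by rewrite mxE.
have [j0 Aj0|A0] := pickP (fun j => A 0 j != 0); last first.
  have [v v0 Av] := IH n.+1 (\matrix_(i, j) A (lift 0 i) j) (ltnW mn).
  exists v => //; apply/matrixP => i j; rewrite ord1 rowE [RHS]mxE {j}.
  case: (unliftP 0 i) => [i'|] ->.
    have /matrixP/(_ i' 0) := Av; rewrite !mxE => Avi.
    by rewrite -[RHS]Avi; apply: eq_bigr => j _; rewrite mxE.
  by rewrite big1 // => j _; move/negbFE/eqP: (A0 j) => ->; rewrite mul0r.
(* Left multiples of the pivot row are subtracted from the other rows: row operations act on the
   left and so respect the right kernel. The pivot coordinate of [w] below is then solved from the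
   first row. *)
have [v v0 Av] := IH n (\matrix_(i, j) (A (lift 0 i) (lift j0 j)
   - A (lift 0 i) j0 * (A 0 j0)^-1 * A 0 (lift j0 j))) mn.
pose w : 'cV[D]_n.+1 := \col_j if unlift j0 j is Some j' then v j' 0
  else - ((A 0 j0)^-1 * \sum_j A 0 (lift j0 j) * v j 0).
have wl j : w (lift j0 j) 0 = v j 0 by rewrite mxE liftK.
have w0 : w j0 0 = - ((A 0 j0)^-1 * \sum_j A 0 (lift j0 j) * v j 0).
  by rewrite mxE unlift_none.
exists w.
  by have /cV_neq0P [j vj] := v0; apply/cV_neq0P; exists (lift j0 j); rewrite wl.
apply/matrixP => i j; rewrite ord1 rowE [RHS]mxE {j}.
rewrite (bigD1_ord j0) //= w0; under eq_bigr do rewrite wl.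
case: (unliftP 0 i) => [i'|] ->; last by rewrite mulrN mulVKr ?addNr ?hD.
have /matrixP/(_ i' 0) := Av; rewrite !mxE => Avi.
rewrite -[RHS]Avi; under [RHS]eq_bigr do rewrite mxE mulrBl.
rewrite sumrB mulrN addrC; congr (_ - _).
by rewrite !mulr_sumr; apply: eq_bigr => j _; rewrite !mulrA.
Qed.

Section Dimension.
Context (D : unitRingType) (hD : division_ring D) (n : nat).
Implicit Types W : set 'cV[D]_n.

Lemma cols_factor W d m (B : 'M[D]_(n, d)) (A : 'M[D]_(n, m)) :
  W = range (mulmx B : 'cV_d -> 'cV_n) -> (forall j, W (col j A)) ->
  exists C : 'M[D]_(d, m), A = B *m C.
Proof.
move=> -> hA; have /choice [c hc] : forall j, exists c : 'cV[D]_d, B *m c = col j A.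
  by move=> j; have [c _ <-] := hA j; exists c.
exists (\matrix_(i, j) c j i 0); apply/matrixP => i j.
have /matrixP/(_ i 0) := hc j; rewrite !mxE => <-.
by apply: eq_bigr => k _; rewrite mxE.
Qed.

(** In coordinates with respect to a basis of [W] the columns form a matrix wider than tall, and its
    kernel vector is a relation between them. *)
Lemma has_dim_dependent W d m (A : 'M[D]_(n, m)) :
  has_dim d W -> (forall j, W (col j A)) -> (d < m)%N ->
  exists2 v : 'cV[D]_m, v != 0 & A *m v = 0.
Proof.
move=> [B [_ WB]] /(cols_factor WB) [C ->] dm.
have [v v0 Cv] := wide_mx_kernel C hD dm.
by exists v => //; rewrite -mulmxA Cv mulmx0.
Qed.

Lemma mulmx_inj0 d (A : 'M[D]_(n, d)) :
  (forall v : 'cV_d, A *m v = 0 -> v = 0) -> injective (mulmx A : 'cV_d -> 'cV_n).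
Proof.
by move=> h u v /eqP; rewrite -subr_eq0 -mulmxBr => /eqP/h/eqP; rewrite subr_eq0 => /eqP.
Qed.

(** A spanning family with as many members as the dimension is free. This is how the dimension in
    [general_position] yields homogeneous coordinates. *)
Lemma range_has_dim_inj d (A : 'M[D]_(n, d)) :
  has_dim d (range (mulmx A : 'cV_d -> 'cV_n)) -> injective (mulmx A : 'cV_d -> 'cV_n).
Proof.
move=> [B [Binj AB]]; apply: mulmx_inj0 => v Av.
have inr m (E : 'M[D]_(n, m)) j : range (mulmx E : 'cV_m -> 'cV_n) (col j E).
  by exists (delta_mx j 0); rewrite // colE.
have [C BC] : exists C : 'M[D]_d, B = A *m C.
  by apply: (cols_factor erefl) => j; rewrite AB; apply: inr.
have [C' AC] : exists C : 'M[D]_d, A = B *m C.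
  by apply: (cols_factor AB) => j; apply: inr.
have C'C (c : 'cV_d) : C' *m (C *m c) = c.
  by apply: Binj; rewrite !mulmxA -AC -BC.
have C'v : C' *m v = 0 by apply: Binj; rewrite mulmxA -AC Av mulmx0.
(* [C | v] is wider than tall, and C' is a left inverse of C that kills v. *)
have d_lt : (d < d + 1)%N by rewrite addn1.
have [w w0 Cw] := wide_mx_kernel (row_mx C v) hD d_lt.
rewrite -[w]vsubmxK mul_row_col in Cw w0.
have wu : usubmx w = 0.
  rewrite -(C'C (usubmx w)); move/(congr1 (mulmx C')): Cw.
  by rewrite mulmxDr [C' *m (v *m _)]mulmxA C'v mul0mx addr0 mulmx0.
move: Cw w0; rewrite wu mulmx0 add0r [dsubmx w]mx11_scalar; set a := dsubmx w 0 0.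
move=> va /cV_neq0P [i]; rewrite -[i]splitK; case: (fintype.split i) => k /=.
  by rewrite col_mxEu mxE eqxx.
rewrite col_mxEd ord1 mxE eqxx mulr1n => a0.
by rewrite -[v]mulmx1 -(mulrV (hD a0)) scalar_mxM mulmxA va mul0mx.
Qed.
End Dimension.

(** * Points and spans *)

Section Points.
Context (D : unitRingType) (hD : division_ring D).

Definition line n (v : 'cV[D]_n) : set 'cV[D]_n := range (fun a : D => v *m a%:M).

Lemma line_id n (v : 'cV[D]_n) : line v v.
Proof. by exists 1; rewrite // mulmx1. Qed.

Lemma line_scale n (v : 'cV[D]_n) a : a != 0 -> line (v *m a%:M) = line v.
Proof.
move=> a0; apply/seteqP; split=> _ [b _ <-].
  by exists (a * b); rewrite // scalar_mxM mulmxA.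
by exists (a^-1 * b); rewrite // -mulmxA -scalar_mxM mulrA mulrV ?mul1r ?hD.
Qed.

Lemma line_basis n (v : 'cV[D]_n) : line v = range (mulmx v : 'cV_1 -> 'cV_n).
Proof.
apply/seteqP; split=> _ [a _ <-]; first by exists a%:M.
by exists (a 0 0); rewrite // -mx11_scalar.
Qed.

Lemma range_right_subspace n d (A : 'M[D]_(n, d)) :
  right_subspace (range (mulmx A : 'cV_d -> 'cV_n)).
Proof.
split; first by exists 0; rewrite // mulmx0.
  by move=> _ _ [u _ <-] [v _ <-]; exists (u + v); rewrite // mulmxDr.
by move=> _ a [u _ <-]; exists (u *m a%:M); rewrite // mulmxA.
Qed.

Lemma image_right_subspace n d (A : 'M[D]_(n, d)) W : right_subspace W ->
  right_subspace [set A *m w | w in W].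
Proof.
move=> [W0 WD WZ]; split; first by exists 0; rewrite // mulmx0.
  by move=> _ _ [u Wu <-] [v Wv <-]; exists (u + v); rewrite ?mulmxDr //; apply: WD.
by move=> _ a [u Wu <-]; exists (u *m a%:M); rewrite ?mulmxA //; apply: WZ.
Qed.

Lemma right_subspace_sum n W (I : Type) (r : seq I) (P : pred I)
    (F : I -> 'cV[D]_n) : right_subspace W ->
  (forall i, P i -> W (F i)) -> W (\sum_(i <- r | P i) F i).
Proof. by move=> [W0 WD _] h; apply: (big_ind W). Qed.

Context (M : nat).
Implicit Types (p q : proj_point D M) (X : set (proj_point D M)).
Implicit Types (v : 'cV[D]_M.+1) (W : set 'cV[D]_M.+1).

Lemma proj_point_ext p q : p = q :> set _ -> p = q.
Proof.
by case: p q => [P hP] [Q hQ] /= e; case: _ / e hQ => hQ; rewrite (Prop_irrelevance hP hQ).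
Qed.

Lemma proj_point_lift p : exists2 v, v != 0 & p = line v :> set _.
Proof.
have [B [Binj pB]] := point_dim p; exists B; last by rewrite line_basis.
apply/eqP => B0; have /matrixP/(_ 0 0) : 1%:M = 0 :> 'cV[D]_1.
  by apply: Binj; rewrite B0 !mul0mx.
by rewrite !mxE eqxx => /eqP; rewrite oner_eq0.
Qed.

Lemma scale_inj0 v a : v != 0 -> v *m a%:M = 0 -> a = 0.
Proof.
move=> /cV_neq0P [i vi] /matrixP/(_ i 0).
rewrite !mxE big_ord1 mxE eqxx mulr1n => /(divring_mul_eq0 hD) [] // vi0.
by rewrite vi0 eqxx in vi.
Qed.

Lemma proj_point_of v : v != 0 -> exists p, p = line v :> set _.
Proof.
move=> v0; suff h : has_dim 1 (line v) by exists (ProjPoint h).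
exists v; split; last exact: line_basis.
apply: mulmx_inj0 => w; rewrite [w]mx11_scalar => /(scale_inj0 v0) ->.
by rewrite raddf0.
Qed.

Lemma point_vector_neq0 p v : p = line v :> set _ -> v != 0.
Proof.
move=> pv; have [w w0 pw] := proj_point_lift p; apply: contra_neq w0 => v0.
by have [a _ <-] : line v w by [rewrite -pv pw; exact: line_id]; rewrite v0 mul0mx.
Qed.

Lemma lies_onE p v W : p = line v :> set _ -> right_subspace W ->
  lies_on p W <-> W v.
Proof.
rewrite /lies_on => -> [_ _ WZ]; split=> [|Wv _ [a _ <-]]; last exact: WZ.
by apply; exact: line_id.
Qed.

Lemma proj_span_right_subspace X : right_subspace (proj_span X).
Proof.
split; first by move=> W [[]].
  by move=> u v Xu Xv W XW; have [[_ WD _] _] := XW; apply: WD; [apply: Xu|apply: Xv].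
by move=> v a Xv W XW; have [[_ _ WZ] _] := XW; apply: WZ; apply: Xv.
Qed.

Lemma proj_span_point X p v : X p -> p = line v :> set _ -> proj_span X v.
Proof. by move=> Xp pv W [_]; apply; exists p; rewrite // pv; exact: line_id. Qed.

Lemma proj_span_sub X W : right_subspace W -> (forall p, X p -> lies_on p W) ->
  proj_span X `<=` W.
Proof. by move=> hW h; apply: smallest_sub => // v [p Xp] /(h p Xp). Qed.

Lemma proj_span_range X d (A : 'M[D]_(M.+1, d)) :
  (forall p, X p -> exists j, p = line (col j A) :> set _) ->
  (forall j, exists2 p, X p & p = line (col j A) :> set _) ->
  proj_span X = range (mulmx A : 'cV_d -> 'cV_M.+1).
Proof.
move=> h1 h2; apply/seteqP; split.
  apply: proj_span_sub => [|p /h1 [j pj]]; first exact: range_right_subspace.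
  rewrite (lies_onE pj); last exact: range_right_subspace.
  by exists (delta_mx j 0); rewrite // colE.
move=> _ [c _ <-]; have -> : A *m c = \sum_j col j A *m (c j 0)%:M.
  apply/matrixP => i k; rewrite ord1 !mxE summxE; apply: eq_bigr => j _.
  by rewrite !mxE big_ord1 !mxE eqxx mulr1n.
apply: right_subspace_sum => [|j _]; first exact: proj_span_right_subspace.
have [_ _ ] := proj_span_right_subspace X; apply.
by have [p Xp pj] := h2 j; apply: proj_span_point Xp pj.
Qed.

Definition cols n d (s : 'I_d -> 'cV[D]_n) : 'M[D]_(n, d) := \matrix_(i, j) s j i 0.

Lemma col_cols n d (s : 'I_d -> 'cV[D]_n) j : col j (cols s) = s j.
Proof. by apply/matrixP => i k; rewrite ord1 !mxE. Qed.

Lemma mul_cols n d (s : 'I_d -> 'cV[D]_n) (c : 'cV_d) :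
  cols s *m c = \sum_j s j *m (c j 0)%:M.
Proof.
apply/matrixP => i k; rewrite ord1 !mxE summxE; apply: eq_bigr => j _.
by rewrite !mxE big_ord1 !mxE eqxx mulr1n.
Qed.

(** Wherever coplanarity is assumed, it is used through this relation: four representatives live in
    a three-dimensional vector space. *)
Lemma coplanar_dependent X (s : 'I_4 -> 'cV[D]_M.+1) : coplanar X ->
  (forall j, exists2 p, X p & p = line (s j) :> set _) ->
  exists2 c : 'cV[D]_4, c != 0 & \sum_j s j *m (c j 0)%:M = 0.
Proof.
move=> [W [dW XW]] hs.
have [|//|c c0 Ac] := has_dim_dependent hD (A := cols s) dW.
  move=> j; rewrite col_cols; have [p Xp ps] := hs j.
  by apply: (XW p Xp); rewrite ps; exact: line_id.
by exists c => //; rewrite -mul_cols.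
Qed.

End Points.

(** * Homogeneous coordinates on the span of x_0, ..., x_4 *)

Section Coordinates.
Context (D : unitRingType).
Implicit Types (w : 'cV[D]_5) (u : 'I_4 -> D).

(* Homogeneous coordinates with respect to x_0 (hgt) and the x_i (crd). *)
Definition hgt w : D := w 0 0.
Definition crd w (i : 'I_4) : D := w (lift ord0 i) 0.
Definition vec (t : D) u : 'cV[D]_5 :=
  \col_k if unlift ord0 k is Some i then u i else t.
Definition unit_at (i m : 'I_4) : D := (m == i)%:R.

Lemma hgt_vec t u : hgt (vec t u) = t.
Proof. by rewrite /hgt mxE unlift_none. Qed.

Lemma crd_vec t u i : crd (vec t u) i = u i.
Proof. by rewrite /crd mxE liftK. Qed.

Lemma hgtD v w : hgt (v + w) = hgt v + hgt w.
Proof. by rewrite /hgt mxE. Qed.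

Lemma crdD v w i : crd (v + w) i = crd v i + crd w i.
Proof. by rewrite /crd mxE. Qed.

Lemma hgtZ w a : hgt (w *m a%:M) = hgt w * a.
Proof. by rewrite /hgt !mxE big_ord1 !mxE eqxx mulr1n. Qed.

Lemma crdZ w a i : crd (w *m a%:M) i = crd w i * a.
Proof. by rewrite /crd !mxE big_ord1 !mxE eqxx mulr1n. Qed.

Lemma hgt0 : hgt 0 = 0.
Proof. by rewrite /hgt mxE. Qed.

Lemma crd0 i : crd 0 i = 0.
Proof. by rewrite /crd mxE. Qed.

Lemma hgt_sum (I : Type) (r : seq I) (P : pred I) F :
  hgt (\sum_(j <- r | P j) F j) = \sum_(j <- r | P j) hgt (F j).
Proof. by rewrite /hgt summxE. Qed.

Lemma crd_sum (I : Type) (r : seq I) (P : pred I) F i :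
  crd (\sum_(j <- r | P j) F j) i = \sum_(j <- r | P j) crd (F j) i.
Proof. by rewrite /crd summxE. Qed.

Lemma coord_ext v w : hgt v = hgt w -> crd v =1 crd w -> v = w.
Proof.
move=> h c; apply/matrixP => k j; rewrite ord1.
by case: (unliftP ord0 k) => [i|] ->; [exact: c|exact: h].
Qed.

Definition coordE := (hgtD, crdD, hgtZ, crdZ, hgt0, crd0, hgt_vec, crd_vec).

Lemma unit_at_id i : unit_at i i = 1.
Proof. by rewrite /unit_at eqxx. Qed.

Lemma unit_at_neq i m : m != i -> unit_at i m = 0.
Proof. by rewrite /unit_at => /negPf ->. Qed.

Lemma mem_uniq4 (i j k l m : 'I_4) : uniq [:: i; j; k; l] -> m \in [:: i; j; k; l].
Proof.
move=> ijkl; have [|/=|_ ->] := @uniq_min_size _ _ (enum 'I_4) ijkl.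
- by move=> n _; rewrite mem_enum.
- by rewrite size_enum_ord.
by rewrite mem_enum.
Qed.

Lemma sum_uniq4 (V : nmodType) (i j k l : 'I_4) (F : 'I_4 -> V) :
  uniq [:: i; j; k; l] -> \sum_m F m = F i + (F j + (F k + F l)).
Proof.
move=> ijkl; have -> : \sum_m F m = \sum_(m in [:: i; j; k; l]) F m.
  by apply: eq_bigl => m; rewrite mem_uniq4.
by rewrite -big_uniq //= !big_cons big_nil addr0.
Qed.

End Coordinates.

Arguments unit_at {D} i m.

Local Notation V0 := (@finset.set0 _).
Local Notation V1 i := (finset.set1 i).
Local Notation V2 i j := (finset.setU (V1 i) (V1 j)).
Local Notation V3 i j k := (finset.setU (V2 i j) (V1 k)).
Local Notation V1234 := (finset.setTfor 'I_4).

(** * Normal form of a hypercube with initial B-constraints *)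

Section NormalForm.
Context (D : unitRingType) (hD : division_ring D) (M : nat).
Implicit Types (x : {set 'I_4} -> proj_point D M) (f : 'I_4 -> 'I_4 -> D).
Implicit Types (E : 'M[D]_(M.+1, 5)) (w : 'cV[D]_5).

Definition frame (e0 : 'cV[D]_M.+1) (e : 'I_4 -> 'cV[D]_M.+1) : 'M[D]_(M.+1, 5) :=
  cols (fun k : 'I_5 => if unlift ord0 k is Some i then e i else e0).

Lemma mul_frame e0 e w :
  frame e0 e *m w = e0 *m (hgt w)%:M + \sum_i e i *m (crd w i)%:M.
Proof.
rewrite mul_cols big_ord_recl unlift_none; congr (_ + _).
by apply: eq_bigr => i _; rewrite liftK.
Qed.

(** The vector e_0 t + e_i + e_j c. The coefficient [c] is a parameter because it is known to be -1
    only after the B-constraint has been used. *)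
Definition edge (t : D) i j c := vec t (fun m => @unit_at D i m + unit_at j m * c).

Lemma mul_frame_origin e0 e : frame e0 e *m vec 1 (fun=> 0) = e0.
Proof.
rewrite mul_frame hgt_vec mulmx1 big1 ?addr0 // => i _.
by rewrite crd_vec raddf0 mulmx0.
Qed.

Lemma mul_frame_axis e0 e i : frame e0 e *m vec 0 (unit_at i) = e i.
Proof.
rewrite mul_frame hgt_vec raddf0 mulmx0 add0r (bigD1 i) //= crd_vec unit_at_id.
rewrite mulmx1 big1 ?addr0 // => j ji.
by rewrite crd_vec unit_at_neq // raddf0 mulmx0.
Qed.

Lemma edgeE t i j c : edge t i j c =
  vec 1 (fun=> 0) *m t%:M + vec 0 (unit_at i) + vec 0 (unit_at j) *m c%:M.
Proof. by apply: coord_ext => [|m]; rewrite !coordE ?mul1r ?mul0r ?addr0 ?add0r. Qed.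

Lemma mul_frame_edge e0 e t i j c :
  frame e0 e *m edge t i j c = e0 *m t%:M + e i + e j *m c%:M.
Proof.
by rewrite edgeE !mulmxDr !mulmxA mul_frame_origin !mul_frame_axis.
Qed.

Lemma proj_span2 (p q : proj_point D M) (v w z : 'cV[D]_M.+1) : p = line v :> set _ ->
  q = line w :> set _ -> (exists a b, z = v *m a%:M + w *m b%:M) ->
  proj_span [set p; q] z.
Proof.
move=> pv qw [a [b ->]]; have [_ WD WZ] := proj_span_right_subspace [set p; q].
by apply: (WD); apply: (WZ); [apply: proj_span_point pv; left | apply: proj_span_point qw; right].
Qed.

Lemma proj_span3 (p q r : proj_point D M) (u v w z : 'cV[D]_M.+1) : p = line u :> set _ ->
  q = line v :> set _ -> r = line w :> set _ -> proj_span [set p; q; r] z ->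
  exists a b c, z = u *m a%:M + v *m b%:M + w *m c%:M.
Proof.
move=> pu qv rw; pose A := cols (fun j : 'I_3 => nth 0 [:: u; v; w] j).
have cA j : col j A = nth 0 [:: u; v; w] j by rewrite col_cols.
rewrite (@proj_span_range _ _ _ _ A) => [[c _ <-]|s|j].
- exists (c ord0 0), (c (lift ord0 ord0) 0), (c (lift ord0 (lift ord0 ord0)) 0).
  by rewrite mul_cols !big_ord_recl big_ord0 /= addr0 addrA.
- case=> [[]|] ->; [exists 0|exists 1|exists (lift ord0 (lift ord0 ord0))];
    by rewrite cA.
rewrite cA; case: j => [[|[|[|//]]] ?] /=; [exists p|exists q|exists r] => //.
- by left; left.
- by left; right.
- by right.
Qed.

(** Each of the three excluded lines rules out one zero coefficient of x_ij on e_0, e_i, e_j; the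
    coefficient of e_i is then normalized to 1. *)
Lemma generic_edge x e0 (e : 'I_4 -> 'cV[D]_M.+1) i j : generic_hypercube x ->
  x V0 = line e0 :> set _ -> (forall i, x (V1 i) = line (e i) :> set _) -> i != j ->
  exists t c, [/\ t != 0, c != 0 &
    x (V2 i j) = line (e0 *m t%:M + e i + e j *m c%:M) :> set _].
Proof.
move=> gx x0 xe ij; have [v v0 xv] := proj_point_lift (x (V2 i j)).
have := vertex2_plane gx ij.
rewrite (lies_onE xv) => [/(proj_span3 x0 (xe i) (xe j)) [a [b [c vE]]]|];
  last exact: proj_span_right_subspace.
have off X : ~ lies_on (x (V2 i j)) (proj_span X) -> ~ proj_span X v.
  by rewrite (lies_onE xv) //; exact: proj_span_right_subspace.
have a0 : a != 0.
  apply/eqP => a0; apply: (off _ (vertex2_line gx ij)).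
  apply: (proj_span2 (xe i) (xe j)); exists b, c.
  by rewrite vE a0 raddf0 mulmx0 add0r.
have b0 : b != 0.
  apply/eqP => b0; rewrite eq_sym in ij; have := vertex2_line0 gx ij.
  rewrite finset.setUC => /off; apply.
  apply: (proj_span2 x0 (xe j)); exists a, c.
  by rewrite vE b0 raddf0 mulmx0 addr0.
have c0 : c != 0.
  apply/eqP => c0; apply: (off _ (vertex2_line0 gx ij)).
  apply: (proj_span2 x0 (xe i)); exists a, b.
  by rewrite vE c0 raddf0 mulmx0 addr0.
have b'0 : b^-1 != 0 by rewrite invr_eq0.
exists (a * b^-1), (c * b^-1); rewrite !(divring_mul_neq0 hD) //; split=> //.
rewrite xv -(line_scale hD v b'0) vE !mulmxDl -!mulmxA -!scalar_mxM.
by rewrite mulrV ?hD // mulmx1.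
Qed.

Lemma generic_frame_inj x e0 e : generic_hypercube x ->
  x V0 = line e0 :> set _ -> (forall i, x (V1 i) = line (e i) :> set _) ->
  injective (mulmx (frame e0 e) : 'cV_5 -> 'cV_M.+1).
Proof.
move=> gx x0 xe; apply: (range_has_dim_inj hD).
rewrite -(@proj_span_range _ _ (x V0 |` [set x (V1 i) | i in setT])).
- exact: general_position gx.
- move=> p [->|[i _ <-]]; [exists ord0|exists (lift ord0 i)].
    by rewrite col_cols unlift_none.
  by rewrite col_cols liftK.
move=> k; rewrite col_cols; case: (unliftP ord0 k) => [i|] _.
  by exists (x (V1 i)) => //; right; exists i.
by exists (x V0) => //; left.
Qed.

Lemma coplanar_relation X E (s : seq 'cV[D]_5) :
  injective (mulmx E : 'cV_5 -> 'cV_M.+1) -> coplanar X ->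
  (forall j : 'I_4, exists2 p, X p & p = line (E *m nth 0 s j) :> set _) ->
  exists2 c : 'I_4 -> D, (exists j, c j != 0) & \sum_(j < 4) nth 0 s j *m (c j)%:M = 0.
Proof.
move=> Einj cX hs; have [c /cV_neq0P [j cj] Ec] := coplanar_dependent hD cX hs.
exists (fun j => c j 0); first by exists j.
apply: Einj; rewrite mulmx0 mulmx_sumr -[RHS]Ec.
by apply: eq_bigr => k _; rewrite mulmxA.
Qed.

(** Antisymmetry of [f] is no field: [V2 i j] is unordered, so [nf_edge] at both orders of the
    indices implies it ([nf_antisym]). The diagonal of [f] is unconstrained. *)
Record normal_form x E f : Prop := NormalForm {
  nf_inj : injective (mulmx E : 'cV_5 -> 'cV_M.+1);
  nf_origin : x V0 = line (E *m vec 1 (fun=> 0)) :> set _;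
  nf_axis : forall i, x (V1 i) = line (E *m vec 0 (unit_at i)) :> set _;
  nf_edge : forall i j, i != j ->
    x (V2 i j) = line (E *m edge (f i j) i j (-1)) :> set _;
  nf_neq0 : forall i j, i != j -> f i j != 0 }.

Lemma edgeN t i j : edge t i j (-1) *m (-1)%:M = edge (- t) j i (-1).
Proof. by apply: coord_ext => [|m]; rewrite !coordE; ncring. Qed.

Lemma normal_form_exists x : generic_hypercube x -> initial_B x ->
  exists E f, normal_form x E f.
Proof.
move=> gx Bx; have [e0 _ x0] := proj_point_lift (x V0).
have [b b0 xb] := proj_point_lift (x (V1 ord0)).
(* The lift [b] of x_1 (direction [ord0]) is fixed beforehand, so that all the x_1j are normalized
   against the same vector; -c is absorbed into the lift of x_j. *)
have /choice [e he] : forall j, exists e, x (V1 j) = line e :> set _ /\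
    (if j == ord0 then e = b else exists2 t, t != 0 &
      x (V2 ord0 j) = line (e0 *m t%:M + b - e) :> set _).
  move=> j; have [->|j0] := eqVneq j ord0; first by exists b.
  have /choice [e xe] : forall i, exists e, x (V1 i) = line e :> set _.
    by move=> i; have [e _ ?] := proj_point_lift (x (V1 i)); exists e.
  pose e' i := if i == ord0 then b else e i.
  have xe' i : x (V1 i) = line (e' i) :> set _ by rewrite /e'; case: eqP => [->|_].
  rewrite eq_sym in j0.
  have [t [c [t0 c0 xt]]] := generic_edge gx x0 xe' j0.
  exists (e' j *m (- c)%:M).
  split; first by rewrite (line_scale hD) ?oppr_eq0.
  by exists t => //; rewrite xt -[e' ord0]/(if true then b else e ord0) raddfN mulmxN opprK.
have xe i := (he i).1.
have eb : e ord0 = b by case: (he ord0).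
have e_ne0 i : i != ord0 -> exists2 t, t != 0 &
    x (V2 ord0 i) = line (frame e0 e *m edge t ord0 i (-1)) :> set _.
  move=> i0; have := (he i).2; rewrite (negPf i0) => -[t t0 xt]; exists t => //.
  by rewrite mul_frame_edge eb raddfN mulmxN mulmx1.
have Einj := generic_frame_inj gx x0 xe.
suff /choice [f hf] : forall ij : 'I_4 * 'I_4, exists t, ij.1 != ij.2 -> t != 0 /\
    x (V2 ij.1 ij.2) = line (frame e0 e *m edge t ij.1 ij.2 (-1)) :> set _.
  exists (frame e0 e), (fun i j => f (i, j)); split=> // [|i|i j ij|i j ij].
  - by rewrite mul_frame_origin.
  - by rewrite mul_frame_axis.
  - by have [] := hf (i, j) ij.
  - by have [] := hf (i, j) ij.
move=> [i j] /=; have [->|ij] := eqVneq i j; first by exists 0.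
have [i0|i0] := eqVneq i ord0.
  rewrite i0 in ij *; rewrite eq_sym in ij.
  by have [t t0 xt] := e_ne0 j ij; exists t.
have [j0|j0] := eqVneq j ord0.
  rewrite j0 finset.setUC; have [t t0 xt] := e_ne0 i i0; exists (- t) => _.
  split; first by rewrite oppr_eq0.
  by rewrite xt -edgeN mulmxA line_scale // oppr_eq0 oner_neq0.
have [t [c [t0 c0 xt]]] := generic_edge gx x0 xe ij.
exists t => _; split=> //; rewrite xt mul_frame_edge.
suff -> : c = -1 by [].
have [r r0 xr] := e_ne0 i i0; have [s s0 xs] := e_ne0 j j0.
have ijk : uniq [:: ord0; i; j] by rewrite /= !inE negb_or !(eq_sym ord0) i0 j0 ij.
(* The constraint on the hexahedron with directions 1, i, j gives a relation between x_0, x_1i, x_1j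
   and x_ij. Its coordinates on e_1, e_i, e_j read a1 + a2 = 0, a3 = a1 and c a3 = a2, whence c a3 =
   - a3. *)
pose ws := [:: vec 1 (fun=> 0); edge r ord0 i (-1); edge s ord0 j (-1); edge t i j c].
have [] := @coplanar_relation _ (frame e0 e) ws Einj (Bx _ _ _ ijk).
  case=> [[|[|[|[|//]]]] ?] /=.
  - by exists (x V0); [left; left; left|rewrite mul_frame_origin].
  - by exists (x (V2 ord0 i)); [left; left; right; rewrite finset.set0U|].
  - by exists (x (V2 ord0 j)); [left; right; rewrite finset.set0U|].
  - by exists (x (V2 i j)); [right; rewrite finset.set0U|rewrite mul_frame_edge].
move=> a [k ak] /=; rewrite !big_ord_recl big_ord0 /=; set a0 := a ord0.
set a1 := a _; set a2 := a _; set a3 := a _ => rel.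
have relm m : unit_at ord0 m * (a1 + a2) + unit_at i m * (a3 - a1)
    + unit_at j m * (c * a3 - a2) = 0.
  have := congr1 (fun w => crd w m) rel; rewrite /edge !coordE => rm; rewrite -[RHS]rm.
  ncring.
have ji : j == i = false by rewrite eq_sym (negPf ij).
have := relm j; have := relm i; have := relm ord0; rewrite /unit_at !eqxx.
rewrite (negPf i0) (negPf j0) (negPf ij) ji ![ord0 == _]eq_sym (negPf i0) (negPf j0) /=.
rewrite !mul0r !mul1r !addr0 !add0r => /eqP; rewrite addr_eq0 => /eqP a12.
move=> /subr0_eq a31 /subr0_eq a32.
(* Without x_ij the relation would be trivial, since x_0, x_1i, x_1j are independent; so a3 can be
   cancelled. *)
have [a3_0|a3_n0] := eqVneq a3 0.
  have a2_0 : a2 = 0 by rewrite -a32 a3_0 mulr0.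
  have a1_0 : a1 = 0 by rewrite -a31.
  have a0_0 : a0 = 0.
    have := congr1 (@hgt D) rel; rewrite /edge !coordE => <-.
    by rewrite a3_0 a2_0 a1_0; ncring.
  suff : a k = 0 by move=> ak0; rewrite ak0 eqxx in ak.
  by case: k ak => [[|[|[|[|//]]]] lk] _;
    [rewrite -[RHS]a0_0|rewrite -[RHS]a1_0|rewrite -[RHS]a2_0|rewrite -[RHS]a3_0];
    congr (a _); apply: val_inj.
apply: (mulIr (hD a3_n0)); rewrite a32 mulN1r a31 a12 opprK //.
Qed.

End NormalForm.

(** * Planes and solids of the hypercube *)

Section Spans.
Context (D : unitRingType) (M : nat).
Context (x : {set 'I_4} -> proj_point D M) (E : 'M[D]_(M.+1, 5)).
Context (f : 'I_4 -> 'I_4 -> D) (nf : normal_form x E f).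
Implicit Types (w : 'cV[D]_5) (P : pred 'I_4) (i j k m : 'I_4).

(** Both edge vectors represent the same point. Their e_i coordinates show that the factor between
    them is -1, and their heights then give the claim. *)
Lemma nf_antisym i j : i != j -> f j i = - f i j.
Proof.
move=> ij; have ji : j != i by rewrite eq_sym.
have [a _] : line (E *m edge (f i j) i j (-1)) (E *m edge (f j i) j i (-1)).
  by rewrite -(nf_edge nf ij) finset.setUC (nf_edge nf ji); exact: line_id.
rewrite -mulmxA => /(nf_inj nf) h.
have a1 : a = -1.
  have := congr1 (fun w => crd w i) h; rewrite /edge !coordE /unit_at !eqxx.
  by rewrite (negPf ij) mul0r addr0 mul1r add0r mul1r.
have := congr1 (@hgt D) h.
by rewrite /edge !coordE a1 mulrN1.
Qed.

(* The solution set of the equation of the span of x_i and the x_ij with P j. *)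
Definition star i P : set 'cV[D]_5 :=
  [set w | hgt w + \sum_(j | P j) f i j * crd w j = 0
         /\ forall m, m != i -> ~~ P m -> crd w m = 0].

Lemma star_right_subspace i P : right_subspace (star i P).
Proof.
split.
- by split=> [|m _ _]; rewrite !coordE // add0r big1 // => j _; rewrite coordE mulr0.
- move=> u v [u0 um] [v0 vm]; split=> [|m mi Pm].
    transitivity ((hgt u + \sum_(j | P j) f i j * crd u j)
                  + (hgt v + \sum_(j | P j) f i j * crd v j)); last first.
      by rewrite u0 v0 addr0.
    rewrite hgtD.
    under eq_bigr do rewrite crdD mulrDr.
    by rewrite big_split /=; ncring.
  by rewrite crdD um ?vm ?addr0.
- move=> u a [u0 um]; split=> [|m mi Pm].
    rewrite -[RHS](mul0r a) -[in RHS]u0 hgtZ mulrDl mulr_suml; congr (_ + _).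
    by apply: eq_bigr => j _; rewrite crdZ mulrA.
by rewrite coordE um ?mul0r.
Qed.

(** With P = {j, k} these are the planes that define x_ijk; with P all indices but i they are the
    solids that define x_1234. *)
Lemma star_span i P : ~~ P i ->
  proj_span (x (V1 i) |` [set x (V2 i j) | j in [set j | P j]])
  = [set E *m w | w in star i P].
Proof.
move=> Pi; have Pne j : P j -> i != j by apply: contraTneq => <-.
have sW := image_right_subspace E (star_right_subspace i P).
apply/seteqP; split.
  apply: proj_span_sub => // _ [->|[j /= Pj <-]].
    rewrite (lies_onE (nf_axis nf i)) //; eexists; last reflexivity.
    split=> [|m mi _]; rewrite !coordE ?unit_at_neq // add0r big1 // => j Pj.
    by rewrite coordE unit_at_neq ?mulr0 // eq_sym Pne.
  have ij := Pne j Pj; rewrite (lies_onE (nf_edge nf ij)) //; eexists; last reflexivity.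
  split=> [|m mi Pm]; rewrite /edge !coordE.
    rewrite (bigD1 j) //= coordE unit_at_id unit_at_neq 1?eq_sym // big1 => [|m].
      by ncring.
    move=> /andP [Pm mj]; rewrite coordE (unit_at_neq _ mj) unit_at_neq 1?eq_sym ?Pne //.
    by rewrite mul0r addr0 mulr0.
  have mj : m != j by apply: contraNneq Pm => ->.
  by rewrite !unit_at_neq // mul0r addr0.
move=> _ [w [w0 wm] <-]; set X := (_ |` _).
(* The coefficient of x_ij must be -w_j to match the coordinate at j. This adds -w_j at i, so e_i
   takes the sum of all coordinates; the heights agree by the equation of [star]. *)
have -> : w = vec 0 (unit_at i) *m (\sum_j crd w j)%:M
   + \sum_(j | P j) edge (f i j) i j (-1) *m (- crd w j)%:M.
  apply: coord_ext => [|m].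
    rewrite hgtD hgt_sum hgtZ hgt_vec mul0r add0r.
    apply/eqP; rewrite -subr_eq0; apply/eqP; rewrite -[RHS]w0 -sumrN; congr (_ + _).
    by apply: eq_bigr => j _; rewrite /edge !coordE mulrN opprK.
  have sum_w : \sum_j crd w j = \sum_(j | P j) crd w j + crd w i.
    rewrite (bigID P) /=; congr (_ + _); rewrite (bigD1 i) //= big1 ?addr0 //.
    by move=> j /andP [Pj ji]; exact: wm.
  rewrite crdD crd_sum crdZ crd_vec sum_w.
  have -> : \sum_(j | P j) crd (edge (f i j) i j (-1) *m (- crd w j)%:M) m
      = \sum_(j | P j) unit_at j m * crd w j - unit_at i m * \sum_(j | P j) crd w j.
    rewrite mulr_sumr -sumrB; apply: eq_bigr => j _; rewrite /edge !coordE.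
    by ncring.
  have -> : \sum_(j | P j) unit_at j m * crd w j = if P m then crd w m else 0.
    case: ifP => Pm; last first.
      rewrite big1 // => j Pj; rewrite unit_at_neq ?mul0r //.
      by apply: contraFneq Pm => ->.
    rewrite (bigD1 m) //= unit_at_id mul1r big1 ?addr0 // => j /andP [_ jm].
    by rewrite unit_at_neq ?mul0r // eq_sym.
  have cancel (a b c : D) : a + b + (c - a) = b + c by ncring.
  rewrite mulrDr cancel.
  have [->|mi] := eqVneq m i.
    by rewrite (negPf Pi) unit_at_id mul1r addr0.
  by rewrite unit_at_neq // mul0r; case: ifP => Pm; rewrite ?add0r // wm ?Pm.
rewrite mulmxDr mulmx_sumr.
have sX := proj_span_right_subspace X; have [_ XD XZ] := sX.
apply: XD; first by rewrite mulmxA; apply: XZ; apply: (proj_span_point _ (nf_axis nf i)); left.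
apply: right_subspace_sum => // j Pj; rewrite mulmxA; apply: XZ.
by apply: (proj_span_point _ (nf_edge nf (Pne j Pj))); right; exists j.
Qed.

End Spans.

(** * The vertices x_ijk, and the final constraints over a commutative division ring *)

Section Triples.
Context (D : unitRingType) (hD : division_ring D) (M : nat).
Context (x : {set 'I_4} -> proj_point D M) (E : 'M[D]_(M.+1, 5)).
Context (f : 'I_4 -> 'I_4 -> D) (nf : normal_form x E f).
Implicit Types (w : 'cV[D]_5) (i j k m : 'I_4).

Definition plane i j k : set 'cV[D]_5 :=
  [set w | hgt w + f i j * crd w j + f i k * crd w k = 0
         /\ forall m, m \notin [:: i; j; k] -> crd w m = 0].

Lemma plane_star i j k : uniq [:: i; j; k] -> plane i j k = star f i (pred2 j k).
Proof.
rewrite /= !inE negb_or !andbT => /andP [/andP [ij ik] jk].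
have sumE w : \sum_(m | pred2 j k m) f i m * crd w m = f i j * crd w j + f i k * crd w k.
  rewrite (bigD1 j) /= ?eqxx // (bigD1 k) /= ?eqxx ?orbT ?[k == j]eq_sym ?(negPf jk) //.
  by rewrite big1 ?addr0 // => m /andP [/andP [/orP [] /eqP -> ]]; rewrite ?eqxx.
apply/seteqP; split=> w [w0 wm]; (split; first by rewrite ?sumE ?addrA // -addrA -sumE) => m.
  by move=> mi; rewrite /= negb_or => /andP [mj mk]; apply: wm; rewrite !inE !negb_or mi mj.
by rewrite !inE !negb_or => /and3P [mi mj mk]; apply: wm; rewrite //= negb_or mj.
Qed.

Lemma plane_span i j k : uniq [:: i; j; k] ->
  proj_span [set x (V1 i); x (V2 i j); x (V2 i k)] = [set E *m w | w in plane i j k].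
Proof.
move=> ijk; rewrite plane_star //.
have -> : [set x (V1 i); x (V2 i j); x (V2 i k)]
    = x (V1 i) |` [set x (V2 i m) | m in [set m | pred2 j k m]].
  apply/seteqP; split=> p.
    by case=> [[->|->]|->]; [left|right; exists j|right; exists k];
      rewrite //= eqxx ?orbT.
  by case=> [->|[m /= /orP [] /eqP -> <-]]; [left; left|left; right|right].
rewrite (star_span nf) //=; move: ijk.
by rewrite /= !inE => /andP [].
Qed.

Lemma lies_on_plane_image i j k (q : proj_point D M) w : uniq [:: i; j; k] ->
  q = line (E *m w) :> set _ -> lies_on q [set E *m w | w in plane i j k] <-> plane i j k w.
Proof.
move=> ijk qw; rewrite plane_star // (lies_onE qw); last first.
  exact/image_right_subspace/star_right_subspace.
by split=> [[v Pv /(nf_inj nf) <-]|Pw] //; exists w.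
Qed.

Definition triple i j k : set 'cV[D]_5 := plane i j k `&` plane j i k `&` plane k i j.

Lemma common_point_triple i j k (q : proj_point D M) : uniq [:: i; j; k] ->
  (forall W, [set proj_span [set x (V1 i); x (V2 i j); x (V2 i k)];
                  proj_span [set x (V1 j); x (V2 i j); x (V2 j k)];
                  proj_span [set x (V1 k); x (V2 i k); x (V2 j k)]] W -> lies_on q W)
  <-> exists2 w, triple i j k w & q = line (E *m w) :> set _.
Proof.
move=> ijk; have jik : uniq [:: j; i; k].
  by move: ijk; rewrite /= !inE !negb_or !andbT [j == i]eq_sym => /andP [/andP [-> ->] ->].
have kij : uniq [:: k; i; j] by rewrite -(rot_uniq 1).
rewrite (plane_span ijk).
have -> : proj_span [set x (V1 j); x (V2 i j); x (V2 j k)]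
    = [set E *m w | w in plane j i k] by rewrite -plane_span // [V2 j i]finset.setUC.
have -> : proj_span [set x (V1 k); x (V2 i k); x (V2 j k)] = [set E *m w | w in plane k i j].
  by rewrite -plane_span // [V2 k i]finset.setUC [V2 k j]finset.setUC.
split=> [h|[w [[wi wj] wk] qw] W]; last first.
  by case=> [[->|->]|->]; apply/(lies_on_plane_image _ qw).
have [v v0 qv] := proj_point_lift q.
have [w _ wv] : [set E *m w | w in plane i j k] v.
  by apply: (h _ (or_introl (or_introl erefl))); rewrite qv; exact: line_id.
rewrite -wv in qv; exists w => //.
split; [split|]; apply/(lies_on_plane_image _ qv) => //; apply: h.
- by left; left.
- by left; right.
- by right.
Qed.

(** Subtracting the plane equations at x_i and x_j eliminates the height. Together with its
    rotations this gives the ratios of the coordinates of x_ijk without inverting g. *)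
Lemma triple_rel i j k w : uniq [:: i; j; k] -> triple i j k w ->
  (f i j + f j k + f k i) * crd w k = f i j * (crd w i + crd w j + crd w k).
Proof.
rewrite /= !inE negb_or !andbT => /andP [/andP [ij ik] jk].
case=> [[[hi _] [hj _]] _].
have fji := nf_antisym nf ij; have fki := nf_antisym nf ik.
apply: subr0_eq; rewrite fki; transitivity ((hgt w + f j i * crd w i + f j k * crd w k)
  - (hgt w + f i j * crd w j + f i k * crd w k)); last by rewrite hi hj subrr.
by rewrite fji; ncring.
Qed.

Lemma plane_swap i j k : plane i j k `<=` plane i k j.
Proof.
move=> v [v0 vm]; split=> [|m]; first by rewrite addrAC.
by rewrite !inE => h; apply: vm; rewrite !inE [(m == j) || _]orbC.
Qed.

Lemma triple_rot i j k : triple i j k `<=` triple j k i.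
Proof. by move=> w [[wi wj] wk]; split; [split; apply: plane_swap|]. Qed.

Lemma triple_swap i j k : triple i j k `<=` triple i k j.
Proof. by move=> w [[wi wj] wk]; split; [split|]; [apply: plane_swap|..]. Qed.

(** The point x_ij always lies on the planes at x_i and x_j; the left side of the equation at x_k
    takes the value f_ij + f_jk + f_ki at it. *)
Lemma edge_triple i j k : uniq [:: i; j; k] -> f i j + f j k + f k i = 0 ->
  triple i j k (edge (f i j) i j (-1)).
Proof.
rewrite /= !inE negb_or !andbT => /andP [/andP [ij ik] jk] g0.
have fji := nf_antisym nf ij; have fkj := nf_antisym nf jk.
have ji : j != i by rewrite eq_sym.
have ki : k != i by rewrite eq_sym.
have kj : k != j by rewrite eq_sym.
have off m : m != i -> m != j -> crd (edge (f i j) i j (-1)) m = 0.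
  by move=> mi mj; rewrite /edge !coordE !unit_at_neq // mul0r addr0.
have ci : crd (edge (f i j) i j (-1)) i = 1.
  by rewrite /edge !coordE unit_at_id unit_at_neq // mul0r addr0.
have cj : crd (edge (f i j) i j (-1)) j = -1.
  by rewrite /edge !coordE unit_at_id unit_at_neq // mul1r add0r.
have ck := off k ki kj.
split; [split|]; (split=> [|m]; last by rewrite !inE !negb_or => /and3P [*]; apply: off).
- by rewrite cj ck /edge hgt_vec; ncring.
- by rewrite ci ck /edge hgt_vec fji; ncring.
by rewrite ci cj /edge hgt_vec -[RHS]g0 fkj; ncring.
Qed.

(* If the sum vanished, the points x_ij, x_jk, x_ik would be collinear, and x_ij
   and x_ik would both be common points of the three planes. *)
Lemma generic_cyclic_neq0 i j k : generic_hypercube x -> uniq [:: i; j; k] ->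
  f i j + f j k + f k i != 0.
Proof.
move=> gx ijk; have := ijk.
rewrite /= !inE negb_or !andbT => /andP [/andP [ij ik] jk].
have fji := nf_antisym nf ij; have fki := nf_antisym nf ik; have fkj := nf_antisym nf jk.
have ji : j != i by rewrite eq_sym.
apply/eqP => g0.
have common (q : proj_point D M) w : triple i j k w -> q = line (E *m w) :> set _ ->
    q = x (V3 i j k).
  move=> tw qw; have := vertex3 gx ijk; rewrite /unique_common_point => /seteqP [h _].
  by apply: h; apply/(common_point_triple _ ijk); exists w.
have e1 := common _ _ (edge_triple ijk g0) (nf_edge nf ij).
have e2 : x (V2 i k) = x (V3 i j k).
  apply: (common _ _ _ (nf_edge nf ik)); apply/triple_swap/edge_triple.
    by rewrite /= !inE negb_or ik ij eq_sym jk.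
  by rewrite -oppr0 -g0 fji fki fkj; ncring.
have [a _] : line (E *m edge (f i k) i k (-1)) (E *m edge (f i j) i j (-1)).
  by rewrite -(nf_edge nf ik) e2 -e1 (nf_edge nf ij); exact: line_id.
rewrite -mulmxA => /(nf_inj nf)/(congr1 (fun w => crd w j))/eqP.
rewrite /edge !coordE unit_at_id !unit_at_neq // mul0r addr0 mul0r mul1r add0r.
by rewrite eq_sym oppr_eq0 oner_eq0.
Qed.

Lemma comm_vertex3 i j k : commutative (@GRing.mul D) -> generic_hypercube x ->
  uniq [:: i; j; k] ->
  exists2 w, plane i j k w /\ hgt w = 0 & x (V3 i j k) = line (E *m w) :> set _.
Proof.
move=> mulC gx ijk; have := vertex3 gx ijk; rewrite /unique_common_point => /seteqP [_ h].
have /(common_point_triple _ ijk) [w tw xw] := h _ erefl.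
exists w => //; have [[pw _] _] := tw; split=> //.
have g0 := generic_cyclic_neq0 gx ijk; set g := (X in X != 0) in g0.
have jki : uniq [:: j; k; i] by rewrite -(rot_uniq 2).
have kij : uniq [:: k; i; j] by rewrite -(rot_uniq 1).
have /andP [/andP [ij ik] jk] : (i != j) && (i != k) && (j != k).
  by move: ijk; rewrite /= !inE negb_or !andbT.
have fki := nf_antisym nf ik.
have rk := triple_rel ijk tw.
have rj := triple_rel kij (triple_rot (triple_rot tw)).
set s := crd w i + crd w j + crd w k in rk.
have sj : crd w k + crd w i + crd w j = s by rewrite -addrA addrC.
have gj : f k i + f i j + f j k = g by rewrite -addrA addrC.
rewrite sj gj in rj.
(* Moving g past f_ij and f_ik turns g w_0 into -(f_ij f_ki + f_ik f_ij) s, which is 0 by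
   commutativity and antisymmetry. *)
suff /(divring_mul_eq0 hD) : g * hgt w = 0.
  by case=> // g0'; rewrite g0' eqxx in g0.
have [w0 _] := pw.
have -> : hgt w = - (f i j * crd w j + f i k * crd w k).
  by apply/eqP; rewrite -addr_eq0 addrA w0.
rewrite mulrN mulrDr ![g * (_ * _)]mulrA ![g * f _ _]mulC -!mulrA rj rk.
by rewrite [f i j * (_ * _)]mulrA [f i j * f k i]mulC fki; ncring.
Qed.

Definition final_plane i j k l : set 'cV[D]_5 :=
  [set w | hgt w = 0 /\ f i j * crd w j + f i k * crd w k + f i l * crd w l = 0].

(** As f_ij is invertible, the second equation solves for w_j and leaves w_i, w_k, w_l free. The
    basis is e_i together with e_k and e_l, each corrected by a multiple of e_j. *)
Lemma final_plane_dim i j k l : uniq [:: i; j; k; l] -> has_dim 3 (final_plane i j k l).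
Proof.
move=> ijkl; have all4 m := mem_uniq4 m ijkl.
move: ijkl; rewrite /= !inE !negb_or !andbT.
move=> /andP [/and3P [ij ik il] /andP [/andP [jk jl] kl]].
pose v k' := @vec D 0 (fun m => unit_at k' m - unit_at j m * (f i j)^-1 * f i k').
pose B := cols (fun a : 'I_3 => nth 0 [:: vec 0 (unit_at i); v k; v l] a).
have hgtB c : hgt (B *m c) = 0.
  rewrite mul_cols !big_ord_recl big_ord0 /= !coordE; ncring.
have crdB c m : crd (B *m c) m = unit_at i m * c ord0 0
    + (unit_at k m - unit_at j m * (f i j)^-1 * f i k) * c (lift ord0 ord0) 0
    + (unit_at l m - unit_at j m * (f i j)^-1 * f i l) * c (lift ord0 (lift ord0 ord0)) 0.
  by rewrite mul_cols !big_ord_recl big_ord0 /= !coordE; ncring.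
have neq_sym (a b : 'I_4) : a != b -> (b == a) = false by rewrite eq_sym => /negPf.
have unitE := (negPf ij, negPf ik, negPf il, negPf jk, negPf jl, negPf kl, neq_sym _ _ ij,
  neq_sym _ _ ik, neq_sym _ _ il, neq_sym _ _ jk, neq_sym _ _ jl, neq_sym _ _ kl).
have [crdBi crdBk crdBl] : [/\ forall c, crd (B *m c) i = c ord0 0,
    forall c, crd (B *m c) k = c (lift ord0 ord0) 0
    & forall c, crd (B *m c) l = c (lift ord0 (lift ord0 ord0)) 0].
  by split=> c; rewrite crdB /unit_at !eqxx ?unitE; ncring.
have crdBj c : crd (B *m c) j = - (f i j)^-1 * f i k * crd (B *m c) k
    - (f i j)^-1 * f i l * crd (B *m c) l.
  by rewrite crdB crdBk crdBl /unit_at !eqxx ?unitE; ncring.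
exists B; split.
  apply: mulmx_inj0 => c Bc; apply/matrixP => a b; rewrite ord1 [RHS]mxE.
  case: a => [[|[|[|//]]] lt_a].
  - by rewrite -[RHS](crd0 D i) -Bc crdBi; congr (c _ _); apply: val_inj.
  - by rewrite -[RHS](crd0 D k) -Bc crdBk; congr (c _ _); apply: val_inj.
  - by rewrite -[RHS](crd0 D l) -Bc crdBl; congr (c _ _); apply: val_inj.
apply/seteqP; split=> [w [w0 wE]|_ [c _ <-]]; last first.
  split; first exact: hgtB.
  rewrite crdBj mulrBr !mulrA !mulrN !mulNr mulrV ?hD ?(nf_neq0 nf) //; ncring.
pose c : 'cV[D]_3 := \col_a nth 0 [:: crd w i; crd w k; crd w l] a.
exists c => //; apply: coord_ext => [|m]; first by rewrite hgtB w0.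
have ck : crd (B *m c) k = crd w k by rewrite crdBk mxE.
have cl : crd (B *m c) l = crd w l by rewrite crdBl mxE.
have := all4 m; rewrite !inE => /or4P [] /eqP -> //.
  by rewrite crdBi mxE.
rewrite crdBj ck cl; apply: (mulrI (hD (nf_neq0 nf ij))).
apply/esym/eqP; rewrite -subr_eq0 -[X in _ == X]wE mulrBr !mulrA !mulrN !mulNr.
by rewrite mulrV ?hD ?(nf_neq0 nf) //; apply/eqP; ncring.
Qed.

(** At x_ijk both w_0 and w_l vanish, so the equation of [final_plane] there is just that of the
    plane of x_i, x_ij, x_ik; likewise for x_ijl and x_ikl. *)
Lemma comm_final_B : commutative (@GRing.mul D) -> generic_hypercube x -> final_B x.
Proof.
move=> mulC gx i j k l ijkl; have := ijkl.
rewrite /= !inE !negb_or !andbT => /andP [/and3P [ij ik il] /andP [/andP [jk jl] kl]].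
have [B [Binj FB]] := final_plane_dim ijkl.
exists [set E *m w | w in final_plane i j k l]; split.
  exists (E *m B); split.
    by move=> u v; rewrite -!mulmxA => /(nf_inj nf)/Binj.
  apply/seteqP; split=> [_ [w + <-]|_ [c _ <-]].
    by rewrite FB => -[c _ <-]; exists c; rewrite ?mulmxA.
  by rewrite -mulmxA; exists (B *m c) => //; rewrite FB; exists c.
have lies (p : proj_point D M) w : p = line (E *m w) :> set _ ->
    final_plane i j k l w -> lies_on p [set E *m w | w in final_plane i j k l].
  move=> pw Fw; rewrite /lies_on pw => _ [a _ <-]; rewrite -mulmxA.
  exists (w *m a%:M) => //; move: Fw; rewrite FB => -[c _ <-]; exists (c *m a%:M) => //.
  by rewrite mulmxA.
move=> p; rewrite !finset.setUA => -[[[->|->]|->]|->].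
- apply: lies (nf_axis nf i) _; split; rewrite !coordE // !unit_at_neq 1?eq_sym //.
  by rewrite !mulr0 !addr0.
- have ijk : uniq [:: i; j; k] by rewrite /= !inE negb_or ij ik jk.
  have [w [[w0 wm] hw] xw] := comm_vertex3 mulC gx ijk.
  apply: lies xw _; split=> //; rewrite (wm l) ?mulr0 ?addr0; last first.
    by rewrite !inE ![l == _]eq_sym !negb_or il jl kl.
  by rewrite -w0 hw add0r.
- have ijl' : uniq [:: i; j; l] by rewrite /= !inE negb_or ij il jl.
  have [w [[w0 wm] hw] xw] := comm_vertex3 mulC gx ijl'.
  apply: lies xw _; split=> //; rewrite (wm k) ?mulr0 ?addr0; last first.
    by rewrite !inE ![k == _]eq_sym !negb_or ik jk eq_sym kl.
  by rewrite -w0 hw add0r.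
have ikl : uniq [:: i; k; l] by rewrite /= !inE negb_or ik il kl.
have [w [[w0 wm] hw] xw] := comm_vertex3 mulC gx ikl.
apply: lies xw _; split=> //; rewrite (wm j) ?mulr0 ?add0r; last first.
  by rewrite !inE !negb_or [j == i]eq_sym ij jk jl.
by rewrite -w0 hw add0r.
Qed.

End Triples.

(** * Hypercubes from coordinates *)

Section Construction.
Context (D : unitRingType) (hD : division_ring D) (M : nat) (hM : (4 <= M)%N).
Implicit Types (i j k l m : 'I_4).

Definition std_frame : 'M[D]_(M.+1, 5) := \matrix_(r, s) (r == s :> nat)%:R.

Lemma std_frame_inj : injective (mulmx std_frame : 'cV_5 -> 'cV_M.+1).
Proof.
apply: mulmx_inj0 => v Ev; apply/matrixP => s u; rewrite ord1 [RHS]mxE.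
have /matrixP/(_ (widen_ord (hM : 5 <= M.+1)%N s) 0) := Ev; rewrite !mxE => <-.
rewrite (bigD1 s) //= mxE eqxx mul1r big1 ?addr0 // => r rs.
by rewrite mxE /= eq_sym (negPf (rs : val r != val s)) mul0r.
Qed.

Lemma ord4_ind (P : 'I_4 -> Prop) :
  P (inord 0) -> P (inord 1) -> P (inord 2) -> P (inord 3) -> forall i, P i.
Proof.
move=> P0 P1 P2 P3 i; rewrite -(inord_val i).
by case: i => [[|[|[|[|]]]]].
Qed.

Lemma inord4_eq a b : (a < 4)%N -> (b < 4)%N -> (inord a == inord b :> 'I_4) = (a == b).
Proof. by move=> a4 b4; rewrite -val_eqE /= !inordK. Qed.

(* w l is the vector of the vertex opposite to x_l, i.e. of x_ijk with
   {i, j, k, l} = {1, 2, 3, 4}, and z that of x_1234. *)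
Context (f : 'I_4 -> 'I_4 -> D) (w : 'I_4 -> 'cV[D]_5) (z : 'cV[D]_5).

(** Membership of the four directions decodes the unordered index set. Each x_ij is lifted with i <
    j; the other order differs by the factor -1, by antisymmetry of [f]. *)
Definition vertex (S : {set 'I_4}) : 'cV[D]_5 :=
  match inord 0 \in S, inord 1 \in S, inord 2 \in S, inord 3 \in S with
  | false, false, false, false => vec 1 (fun=> 0)
  | true, false, false, false => vec 0 (unit_at (inord 0))
  | false, true, false, false => vec 0 (unit_at (inord 1))
  | false, false, true, false => vec 0 (unit_at (inord 2))
  | false, false, false, true => vec 0 (unit_at (inord 3))
  | true, true, false, false => edge (f (inord 0) (inord 1)) (inord 0) (inord 1) (-1)
  | true, false, true, false => edge (f (inord 0) (inord 2)) (inord 0) (inord 2) (-1)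
  | true, false, false, true => edge (f (inord 0) (inord 3)) (inord 0) (inord 3) (-1)
  | false, true, true, false => edge (f (inord 1) (inord 2)) (inord 1) (inord 2) (-1)
  | false, true, false, true => edge (f (inord 1) (inord 3)) (inord 1) (inord 3) (-1)
  | false, false, true, true => edge (f (inord 2) (inord 3)) (inord 2) (inord 3) (-1)
  | false, true, true, true => w (inord 0)
  | true, false, true, true => w (inord 1)
  | true, true, false, true => w (inord 2)
  | true, true, true, false => w (inord 3)
  | true, true, true, true => z
  end.

Lemma vertex0 : vertex V0 = vec 1 (fun=> 0).
Proof. by rewrite /vertex !inE. Qed.

Lemma vertex1 i : vertex (V1 i) = vec 0 (unit_at i).
Proof. by elim/ord4_ind: i; rewrite /vertex !inE !inord4_eq. Qed.

Lemma vertex2 i j : (i < j)%N -> vertex (V2 i j) = edge (f i j) i j (-1).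
Proof.
by elim/ord4_ind: i; elim/ord4_ind: j; rewrite !inordK // => _; rewrite /vertex !inE !inord4_eq.
Qed.

Lemma vertex_compl l : vertex (finset.setC (V1 l)) = w l.
Proof. by elim/ord4_ind: l; rewrite /vertex !inE !inord4_eq. Qed.

Lemma vertex_full : vertex V1234 = z.
Proof. by rewrite /vertex !inE. Qed.

(** When f_ii = 0, its vanishing is the equation of the solid spanned by x_i and the x_ij. *)
Definition weighted_sum (i : 'I_4) v := hgt v + \sum_j f i j * crd v j.

(** Sufficient conditions for a generic hypercube. Uniqueness of x_ijk is not among them, as it
    follows from the normalization [w_sum]; [z_unique] and [wz_span] supply uniqueness of x_1234 and
    [span_vertices]. *)
Context (fii : forall i, f i i = 0) (f_neq0 : forall i j, i != j -> f i j != 0).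
Context (f_anti : forall i j, f j i = - f i j).
Context (w_l : forall l, crd (w l) l = 0) (w_sum : forall l, \sum_m crd (w l) m = 1).
Context (w_star : forall l i, i != l -> weighted_sum i (w l) = 0).
Context (z_neq0 : z != 0) (z_star : forall i, weighted_sum i z = 0).
Context (z_unique : forall v, (forall i, weighted_sum i v = 0) -> exists s, v = z *m s%:M).
Context (wz_span : forall W, right_subspace W -> W z -> (forall l, W (w l)) -> forall v, W v).

Lemma vertex_neq0 S : vertex S != 0.
Proof.
have vec0 : vec 1 (fun=> 0) != 0 :> 'cV[D]_5.
  by apply/eqP => /(congr1 (@hgt D))/eqP; rewrite !coordE oner_eq0.
have axis i : vec 0 (unit_at i) != 0 :> 'cV[D]_5.
  by apply/eqP => /(congr1 (fun v => crd v i))/eqP; rewrite !coordE unit_at_id oner_eq0.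
have edge0 i j : i != j -> edge (f i j) i j (-1) != 0.
  by move=> ij; apply/eqP => /(congr1 (@hgt D))/eqP; rewrite !coordE; apply/negP/f_neq0.
have w0 l : w l != 0.
  apply/eqP => wl; have /eqP := w_sum l; rewrite wl big1 ?[0 == _]eq_sym ?oner_eq0 // => m _.
  by rewrite crd0.
rewrite /vertex.
by do 4!case: (_ \in S) => //; apply: edge0; rewrite inord4_eq.
Qed.

Lemma hypercube_exists : exists x : {set 'I_4} -> proj_point D M,
  forall S, x S = line (std_frame *m vertex S) :> set _.
Proof.
have /choice [x hx] : forall S, exists p : proj_point D M,
    p = line (std_frame *m vertex S) :> set _.
  move=> S; apply: (proj_point_of hD); apply: contraNneq (vertex_neq0 S) => ES.
  by apply/eqP/std_frame_inj; rewrite ES mulmx0.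
by exists x.
Qed.

Context (x : {set 'I_4} -> proj_point D M).
Context (hx : forall S, x S = line (std_frame *m vertex S) :> set _).

Lemma hypercube_normal_form : normal_form x std_frame f.
Proof.
split=> //.
- exact: std_frame_inj.
- by rewrite hx vertex0.
- by move=> i; rewrite hx vertex1.
move=> i j; rewrite neq_ltn => /orP [] ij; first by rewrite hx vertex2.
rewrite hx finset.setUC vertex2 // (f_anti j i) -edgeN mulmxA line_scale //.
by rewrite oppr_eq0 oner_eq0.
Qed.

Let nf := hypercube_normal_form.

Let x_compl l : x (finset.setC (V1 l)) = line (std_frame *m w l) :> set _.
Proof. by rewrite hx vertex_compl. Qed.

Let x_full : x V1234 = line (std_frame *m z) :> set _.
Proof. by rewrite hx vertex_full. Qed.

Lemma uniq3_ext i j k : uniq [:: i; j; k] -> exists l, uniq [:: i; j; k; l].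
Proof.
move=> ijk; have [l lijk|h] := pickP (fun l => l \notin [:: i; j; k]).
  by exists l; rewrite -[_ :: _]/(rcons [:: i; j; k] l) rcons_uniq lijk.
have /(uniq_leq_size (enum_uniq _)) : {subset enum 'I_4 <= [:: i; j; k]}.
  by move=> l _; apply/negbFE/h.
by rewrite size_enum_ord.
Qed.

Lemma weighted_sum4 i j k l v : uniq [:: i; j; k; l] ->
  weighted_sum i v = hgt v + f i j * crd v j + f i k * crd v k + f i l * crd v l.
Proof.
by move=> ijkl; rewrite /weighted_sum (sum_uniq4 _ ijkl) fii mul0r add0r !addrA.
Qed.

Lemma plane_compl i j k l : uniq [:: i; j; k; l] -> plane f i j k (w l).
Proof.
move=> ijkl; have il : i != l.
  by move: ijkl; rewrite /= !inE !negb_or => /andP [/and3P []].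
split=> [|m mijk].
  by have := w_star il; rewrite (weighted_sum4 _ ijkl) w_l mulr0 addr0.
suff -> : m = l by [].
move: (mem_uniq4 m ijkl); rewrite !inE; move: mijk; rewrite !inE !negb_or.
by move=> /and3P [/negPf -> /negPf -> /negPf ->] /eqP.
Qed.

Lemma triple_compl i j k l : uniq [:: i; j; k; l] -> triple f i j k (w l).
Proof.
move=> ijkl; have perm i' j' k' : perm_eq [:: i; j; k] [:: i'; j'; k'] ->
    plane f i' j' k' (w l).
  rewrite -(perm_cat2r [:: l]) => /perm_uniq e; apply: plane_compl.
  by rewrite -[uniq _]e.
split; [split|]; apply: perm => //.
- by rewrite (perm_catCA [:: i] [:: j] [:: k]).
- by rewrite perm_sym -(perm_rot 1).
Qed.

Lemma compl_sum i j k l : uniq [:: i; j; k; l] ->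
  crd (w l) i + crd (w l) j + crd (w l) k = 1.
Proof. by move=> ijkl; rewrite -(w_sum l) (sum_uniq4 _ ijkl) w_l addr0 addrA. Qed.

(** With coordinates summing to 1, [triple_rel] reads g w_k = f_ij, and the right side is
    nonzero. *)
Lemma compl_cyclic_neq0 i j k l : uniq [:: i; j; k; l] -> f i j + f j k + f k i != 0.
Proof.
move=> ijkl; have ijk : uniq [:: i; j; k].
  by move: ijkl; rewrite -[_ :: _]/([:: i; j; k] ++ [:: l]) cat_uniq => /andP [].
have := triple_rel nf ijk (triple_compl ijkl); rewrite compl_sum // mulr1.
move=> gE; apply/eqP => g0; move: gE; rewrite g0 mul0r => /esym/eqP; apply/negP/f_neq0.
by move: ijk; rewrite /= !inE negb_or => /andP [/andP []].
Qed.

(** Cancelling g in [triple_rel] determines every coordinate from their sum, and a plane equation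
    then determines the height. *)
Lemma triple_unique i j k l v : uniq [:: i; j; k; l] -> triple f i j k v ->
  v = w l *m (crd v i + crd v j + crd v k)%:M.
Proof.
move=> ijkl tv; set s := _ + _ + _.
have tw := triple_compl ijkl; have sw := compl_sum ijkl.
have ijk : uniq [:: i; j; k].
  by move: ijkl; rewrite -[_ :: _]/([:: i; j; k] ++ [:: l]) cat_uniq => /andP [].
have kij : uniq [:: k; i; j] by rewrite -(rot_uniq 1).
have jki : uniq [:: j; k; i] by rewrite -(rot_uniq 2).
have g0 := compl_cyclic_neq0 ijkl; set g := (X in X != 0) in g0.
have gj : f k i + f i j + f j k = g by rewrite -addrA addrC.
have gi : f j k + f k i + f i j = g by rewrite addrC addrA.
have crd_k : crd v k = crd (w l) k * s.
  apply: (mulrI (hD g0)); rewrite mulrA (triple_rel nf ijk tv).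
  by rewrite (triple_rel nf ijk tw) sw mulr1.
have crd_j : crd v j = crd (w l) j * s.
  apply: (mulrI (hD g0)); rewrite mulrA -gj (triple_rel nf kij (triple_rot (triple_rot tv))).
  rewrite (triple_rel nf kij (triple_rot (triple_rot tw))).
  have -> : crd (w l) k + crd (w l) i + crd (w l) j = 1 by rewrite -sw -addrA addrC.
  by rewrite mulr1 /s -addrA addrC.
have crd_i : crd v i = crd (w l) i * s.
  apply: (mulrI (hD g0)); rewrite mulrA -gi (triple_rel nf jki (triple_rot tv)).
  rewrite (triple_rel nf jki (triple_rot tw)).
  have -> : crd (w l) j + crd (w l) k + crd (w l) i = 1 by rewrite -sw addrC addrA.
  by rewrite mulr1 /s addrC addrA.
have [[[hv offv] _] _] := tv; have [[[hw offw] _] _] := tw.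
apply: coord_ext => [|m]; rewrite !coordE.
  apply: (addIr (f i j * crd v j + f i k * crd v k)); rewrite addrA hv.
  by rewrite crd_j crd_k !mulrA -!mulrDl addrA hw mul0r.
have [|mijk] := boolP (m \in [:: i; j; k]); last by rewrite offv // offw // mul0r.
by rewrite !inE => /or3P [] /eqP ->.
Qed.

Lemma V3_compl i j k l : uniq [:: i; j; k; l] -> V3 i j k = finset.setC (V1 l).
Proof.
move=> ijkl; apply/setP => m; rewrite !inE; have := mem_uniq4 m ijkl; rewrite !inE -!orbA.
have [->|ml] := eqVneq m l; last by rewrite orbF.
move: ijkl; rewrite -(rot_uniq 3) /= !inE !negb_or.
by move=> /andP [/and3P [/negPf -> /negPf -> /negPf ->]].
Qed.

Lemma hypercube_vertex3 i j k : uniq [:: i; j; k] -> unique_common_point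
  [set proj_span [set x (V1 i); x (V2 i j); x (V2 i k)];
       proj_span [set x (V1 j); x (V2 i j); x (V2 j k)];
       proj_span [set x (V1 k); x (V2 i k); x (V2 j k)]] (x (V3 i j k)).
Proof.
move=> ijk; have [l ijkl] := uniq3_ext ijk.
apply/seteqP; split=> [q /(common_point_triple nf _ ijk) [v tv qv]|_ ->]; last first.
  apply/(common_point_triple nf _ ijk); exists (w l); first exact: triple_compl.
  by rewrite (V3_compl ijkl) x_compl.
have vE := triple_unique ijkl tv; set s := (X in X%:M) in vE.
apply: proj_point_ext; rewrite (V3_compl ijkl) x_compl qv vE mulmxA line_scale //.
have := point_vector_neq0 qv; apply: contra_neq => s0.
by rewrite vE s0 raddf0 !mulmx0.
Qed.

Lemma hypercube_vertex4 : unique_common_point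
  [set proj_span (x (V1 i) |` [set x (V2 i j) | j in [set j | j != i]]) | i in setT]
  (x V1234).
Proof.
have starE i v : star f i (predC1 i) v <-> weighted_sum i v = 0.
  rewrite /weighted_sum (bigD1 i) //= fii mul0r add0r.
  by split=> [[]|h] //; split=> // m mi; rewrite /= mi.
have spanE i : proj_span (x (V1 i) |` [set x (V2 i j) | j in [set j | j != i]])
    = [set std_frame *m v | v in star f i (predC1 i)].
  by rewrite -(star_span nf) //= eqxx.
have lies i (q : proj_point D M) v : q = line (std_frame *m v) :> set _ ->
    lies_on q [set std_frame *m v | v in star f i (predC1 i)] <-> weighted_sum i v = 0.
  move=> qv; rewrite (lies_onE qv) -?starE; last exact/image_right_subspace/star_right_subspace.
  by split=> [[u Pu /std_frame_inj <-]|Pv] //; exists v.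
apply/seteqP; split=> [q qF|_ -> _ [i _ <-]]; last first.
  by rewrite spanE; apply/(lies _ _ _ x_full)/z_star.
have qi i : lies_on q [set std_frame *m v | v in star f i (predC1 i)].
  by rewrite -spanE; apply: qF; exists i.
have [u u0 qu] := proj_point_lift q.
have [v _ vu] : [set std_frame *m v | v in star f ord0 (predC1 ord0)] u.
  by apply: qi; rewrite qu; exact: line_id.
rewrite -vu in qu; have [s vE] : exists s, v = z *m s%:M.
  by apply: z_unique => i; apply/(lies _ _ _ qu)/qi.
apply: proj_point_ext; rewrite x_full qu vE mulmxA line_scale //.
have := point_vector_neq0 qu; apply: contra_neq => s0.
by rewrite vE s0 raddf0 !mulmx0.
Qed.

Lemma span_axes : proj_span (x V0 |` [set x (V1 i) | i in setT])
  = range (mulmx std_frame : 'cV_5 -> 'cV_M.+1).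
Proof.
have colE0 : col ord0 std_frame = std_frame *m vec 1 (fun=> 0).
  rewrite colE; congr (_ *m _); apply: coord_ext => [|i]; rewrite ?hgt_vec ?crd_vec.
    by rewrite /hgt mxE eqxx.
  by rewrite /crd mxE.
have colE1 i : col (lift ord0 i) std_frame = std_frame *m vec 0 (unit_at i).
  rewrite colE; congr (_ *m _); apply: coord_ext => [|j]; rewrite ?hgt_vec ?crd_vec.
    by rewrite /hgt mxE.
  by rewrite /crd mxE (inj_eq lift_inj) andbT.
apply: proj_span_range => [p [->|[i _ <-]]|k].
- by exists ord0; rewrite colE0 (nf_origin nf).
- by exists (lift ord0 i); rewrite colE1 (nf_axis nf).
case: (unliftP ord0 k) => [i|] ->.
  by exists (x (V1 i)); [right; exists i|rewrite colE1 (nf_axis nf)].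
by exists (x V0); [left|rewrite colE0 (nf_origin nf)].
Qed.

(** A right linear form [g] that vanishes on [X] but not at [p] separates [p] from the span. The
    excluded lines of the x_ij are checked with the forms w_j and w_0. *)
Lemma proj_span_not_lies (X : set (proj_point D M)) (p : proj_point D M) v
    (g : 'cV[D]_5 -> D) : (forall u u', g (u + u') = g u + g u') ->
  (forall u a, g (u *m a%:M) = g u * a) ->
  (forall q, X q -> exists2 u, g u = 0 & q = line (std_frame *m u) :> set _) ->
  p = line (std_frame *m v) :> set _ -> g v != 0 -> ~ lies_on p (proj_span X).
Proof.
move=> gD gZ hX pv gv0 pX.
pose W : set 'cV[D]_5 := [set u | g u = 0].
have sW : right_subspace W.
  split.
  - by have := gZ 0 0; rewrite mul0mx mulr0.
  - by move=> u u' Wu Wu'; rewrite /W /= gD Wu Wu' addr0.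
  - by move=> u a Wu; rewrite /W /= gZ Wu mul0r.
have sEW := image_right_subspace std_frame sW.
have Xv : proj_span X (std_frame *m v).
  exact/(lies_onE pv (proj_span_right_subspace X)).
have : [set std_frame *m u | u in W] (std_frame *m v).
  apply: (proj_span_sub sEW _ Xv) => q /hX [u gu qu].
  by apply/(lies_onE qu sEW); exists u.
by case=> u Wu /std_frame_inj uv; move: gv0; rewrite -uv Wu eqxx.
Qed.

Lemma hypercube_generic : generic_hypercube x.
Proof.
split.
- by rewrite span_axes; exists std_frame; split=> //; exact: std_frame_inj.
- move=> i j ij; apply/(lies_onE (nf_edge nf ij) (proj_span_right_subspace _)).
  rewrite edgeE !mulmxDr !mulmxA.
  have [_ XD XZ] := proj_span_right_subspace [set x V0; x (V1 i); x (V1 j)].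
  apply: (XD); [apply: (XD); [apply: XZ|]|apply: XZ].
  + by apply: (proj_span_point _ (nf_origin nf)); left; left.
  + by apply: (proj_span_point _ (nf_axis nf i)); left; right.
  + by apply: (proj_span_point _ (nf_axis nf j)); right.
- move=> i j ij; apply: (proj_span_not_lies (g := fun v => crd v j) _ _ _ (nf_edge nf ij)).
  + by move=> u u'; rewrite crdD.
  + by move=> u a; rewrite crdZ.
  + move=> q [->|->]; eexists.
    2: exact: nf_origin nf.
    3: exact: nf_axis nf i.
      by rewrite crd_vec.
    by rewrite crd_vec unit_at_neq // eq_sym.
  + have ji : j != i by rewrite eq_sym.
    by rewrite /edge crd_vec unit_at_id unit_at_neq // add0r mul1r oppr_eq0 oner_eq0.
- move=> i j ij; apply: (proj_span_not_lies (g := @hgt D) _ _ _ (nf_edge nf ij)).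
  + exact: hgtD.
  + exact: hgtZ.
  + move=> q [->|->]; eexists.
    2: exact: nf_axis nf i.
    3: exact: nf_axis nf j.
      by rewrite hgt_vec.
    by rewrite hgt_vec.
  + by rewrite /edge hgt_vec f_neq0.
- exact: hypercube_vertex3.
- exact: hypercube_vertex4.
rewrite span_axes; apply/seteqP; split=> [_ [v _ <-]|]; last first.
  apply: proj_span_sub => [|q [->|[l _ <-]]]; first exact: range_right_subspace.
    by apply/(lies_onE x_full (range_right_subspace _)); exists z.
  by apply/(lies_onE (x_compl l) (range_right_subspace _)); exists (w l).
set S := proj_span _; have sS : right_subspace S := proj_span_right_subspace _.
have [S0 SD SZ] := sS.
apply: (wz_span (W := [set v | S (std_frame *m v)])).
- split=> [|u u' Su Su'|u a Su] /=.
  + by rewrite mulmx0.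
  + by rewrite mulmxDr; apply: SD.
  + by rewrite mulmxA; apply: SZ.
- by apply: (proj_span_point _ x_full); left.
by move=> l; apply: (proj_span_point _ (x_compl l)); right; exists l.
Qed.

(** Modulo e_0, the third of e_i - e_j, e_i - e_k, e_j - e_k is the difference of the other two, so
    e_0 and the first two span a plane containing all four points. *)
Lemma hypercube_initial_B : initial_B x.
Proof.
move=> i j k; rewrite /= !inE negb_or !andbT => /andP [/andP [ij ik] jk].
have ji : j != i by rewrite eq_sym.
have ki : k != i by rewrite eq_sym.
have kj : k != j by rewrite eq_sym.
pose v m : 'cV[D]_5 := edge 0 i m (-1).
pose B := cols (fun a : 'I_3 => nth 0 [:: vec 1 (fun=> 0); v j; v k] a).
have BE c : B *m c = vec 1 (fun=> 0) *m (c ord0 0)%:M + (v j *m (c (lift ord0 ord0) 0)%:M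
    + v k *m (c (lift ord0 (lift ord0 ord0)) 0)%:M).
  by rewrite mul_cols !big_ord_recl big_ord0 /= addr0.
have hgtB c : hgt (B *m c) = c ord0 0 by rewrite BE /v /edge !coordE; ncring.
have crdBj c : crd (B *m c) j = - c (lift ord0 ord0) 0.
  by rewrite BE /v /edge !coordE unit_at_id !unit_at_neq //; ncring.
have crdBk c : crd (B *m c) k = - c (lift ord0 (lift ord0 ord0)) 0.
  by rewrite BE /v /edge !coordE unit_at_id !unit_at_neq //; ncring.
exists (range (mulmx (std_frame *m B) : 'cV_3 -> 'cV_M.+1)); split.
  exists (std_frame *m B); split=> //; apply: mulmx_inj0 => c.
  rewrite -mulmxA => EBc; have Bc : B *m c = 0 by apply: std_frame_inj; rewrite EBc mulmx0.
  apply/matrixP => a b; rewrite ord1 [RHS]mxE; case: a => [[|[|[|//]]] lt_a].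
  - by rewrite -[RHS](@hgt0 D) -Bc hgtB; congr (c _ _); apply: val_inj.
  - by apply: oppr_inj; rewrite oppr0 -[RHS](crd0 D j) -Bc crdBj; congr (- c _ _); apply: val_inj.
  - by apply: oppr_inj; rewrite oppr0 -[RHS](crd0 D k) -Bc crdBk; congr (- c _ _); apply: val_inj.
have lies (p : proj_point D M) u c0 c1 c2 : p = line (std_frame *m u) :> set _ ->
    u = vec 1 (fun=> 0) *m c0%:M + (v j *m c1%:M + v k *m c2%:M) ->
    lies_on p (range (mulmx (std_frame *m B) : 'cV_3 -> 'cV_M.+1)).
  move=> pu uE; apply/(lies_onE pu (range_right_subspace _)).
  exists (\col_a nth 0 [:: c0; c1; c2] a) => //; rewrite -mulmxA BE !mxE /=.
  by rewrite -uE.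
move=> p; rewrite !finset.set0U => -[[[->|->]|->]|->].
- apply: (lies _ _ 1 0 0 (nf_origin nf)).
  by apply: coord_ext => [|m]; rewrite /v /edge !coordE; ncring.
- apply: (lies _ _ (f i j) 1 0 (nf_edge nf ij)).
  by apply: coord_ext => [|m]; rewrite /v /edge !coordE; ncring.
- apply: (lies _ _ (f i k) 0 1 (nf_edge nf ik)).
  by apply: coord_ext => [|m]; rewrite /v /edge !coordE; ncring.
apply: (lies _ _ (f j k) (-1) 1 (nf_edge nf jk)).
by apply: coord_ext => [|m]; rewrite /v /edge !coordE; ncring.
Qed.

End Construction.

(** * The counterexample over a noncommutative division ring *)

Section Counterexample.
Context (D : unitRingType) (hD : division_ring D) (M : nat) (hM : (4 <= M)%N).
(* b stands for the inverse of the b of the header, and c for f_34; the equation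
   cb is c = b^-1 + 1 - a multiplied by b. *)
Context (a b c : D) (cb : c * b = 1 + b - a * b).
Context (a0 : a != 0) (c0 : c != 0) (p0 : 1 + b - b * a != 0).
Context (ab : a * b - b * a != 0).

Definition quad (t u0 u1 u2 u3 : D) := vec t (fun m => nth 0 [:: u0; u1; u2; u3] m).

Lemma quad_eta v : v = quad (hgt v) (crd v (inord 0)) (crd v (inord 1))
  (crd v (inord 2)) (crd v (inord 3)).
Proof.
apply: coord_ext => [|m]; rewrite !coordE //.
by case: m => [[|[|[|[|//]]]] ?] /=; congr crd; apply: val_inj; rewrite /= inordK.
Qed.

Lemma quadD t u0 u1 u2 u3 t' v0 v1 v2 v3 : quad t u0 u1 u2 u3 + quad t' v0 v1 v2 v3
  = quad (t + t') (u0 + v0) (u1 + v1) (u2 + v2) (u3 + v3).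
Proof.
by apply: coord_ext => [|m]; rewrite !coordE //; case: m => [[|[|[|[|//]]]] ?].
Qed.

Lemma quadZ t u0 u1 u2 u3 s : quad t u0 u1 u2 u3 *m s%:M
  = quad (t * s) (u0 * s) (u1 * s) (u2 * s) (u3 * s).
Proof.
by apply: coord_ext => [|m]; rewrite !coordE //; case: m => [[|[|[|[|//]]]] ?].
Qed.

Definition ce_edges : seq (seq D) :=
  [:: [:: 0; 1; a; 1]; [:: -1; 0; a; 1]; [:: - a; - a; 0; c]; [:: -1; -1; - c; 0]].
Definition ce_f (i j : 'I_4) : D := nth 0 (nth [::] ce_edges i) j.

(** These are the ratios g^-1 f_jk : g^-1 f_ki : g^-1 f_ij, with g^-1 = b for x_234 and x_134 and
    g^-1 = 1 for x_124 and x_123. The entry [1 + b - b * a] is b f_34. *)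
Definition ce_w (l : 'I_4) : 'cV[D]_5 := nth 0
  [:: quad (a * b - b * a) 0 (1 + b - b * a) (- b) (b * a);
      quad (a * b - b * a) (1 + b - b * a) 0 (- b) (b * a);
      quad 0 1 (-1) 0 1;
      quad 0 a (- a) 1 0] l.

(** The solution of the four solid equations with w_4 = 1, obtained by the elimination in
    [ce_z_unique]. *)
Definition ce_z : 'cV[D]_5 := quad (- c) (- (c + a - 1)) (c + a - 1) (-1) 1.

Lemma ce_f_diag i : ce_f i i = 0.
Proof. by case: i => [[|[|[|[|//]]]] ?]. Qed.

Lemma ce_f_anti i j : ce_f j i = - ce_f i j.
Proof.
by case: i => [[|[|[|[|//]]]] ?]; case: j => [[|[|[|[|//]]]] ?];
  rewrite /ce_f /= ?oppr0 ?opprK.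
Qed.

Lemma ce_f_neq0 i j : i != j -> ce_f i j != 0.
Proof.
by case: i => [[|[|[|[|//]]]] ?]; case: j => [[|[|[|[|//]]]] ?] // _;
  rewrite /ce_f /= ?oppr_eq0 ?oner_eq0.
Qed.

Lemma ce_w_diag l : crd (ce_w l) l = 0.
Proof. by case: l => [[|[|[|[|//]]]] ?]; rewrite /ce_w /= crd_vec. Qed.

Lemma ce_w_sum l : \sum_m crd (ce_w l) m = 1.
Proof.
rewrite !big_ord_recl big_ord0.
by case: l => [[|[|[|[|//]]]] ?]; rewrite /ce_w /= !crd_vec /=; ncring.
Qed.

Lemma ce_w_star l i : i != l -> weighted_sum ce_f i (ce_w l) = 0.
Proof.
rewrite /weighted_sum !big_ord_recl big_ord0.
case: l => [[|[|[|[|//]]]] ?]; case: i => [[|[|[|[|//]]]] ?] // _;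
  rewrite /ce_w /ce_f /= !hgt_vec !crd_vec /=; try ncring.
(* What remains are the equations at x_3 and x_4 for x_134 and x_234, where f_34 meets a nonzero
   coordinate; they need the relation [cb]. *)
all: try by (transitivity ((c * b - (1 + b - a * b)) * a); [ncring|rewrite cb subrr mul0r]).
all: by (transitivity (c * b - (1 + b - a * b)); [ncring|rewrite cb subrr]).
Qed.

Lemma ce_z_neq0 : ce_z != 0.
Proof.
by apply/eqP => /(congr1 (@hgt D))/eqP; rewrite hgt_vec hgt0 oppr_eq0 (negPf c0).
Qed.

Lemma ce_z_star i : weighted_sum ce_f i ce_z = 0.
Proof.
rewrite /weighted_sum !big_ord_recl big_ord0.
by case: i => [[|[|[|[|//]]]] ?]; rewrite /ce_z /ce_f /= !hgt_vec !crd_vec /=; ncring.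
Qed.

Lemma ce_z_unique v : (forall i, weighted_sum ce_f i v = 0) -> exists s, v = ce_z *m s%:M.
Proof.
rewrite (quad_eta v); move: (hgt v) (crd v _) (crd v _) (crd v _) (crd v _).
(* The patterns were generalized from right to left, so [v0] is the coordinate at [inord 0]. The
   factor is [v3] because [ce_z] ends in 1. *)
move=> t v3 v2 v1 v0 h; exists v3.
have eqn k : (k < 4)%N -> t + nth 0 (nth [::] ce_edges k) 0%N * v0
   + nth 0 (nth [::] ce_edges k) 1%N * v1 + nth 0 (nth [::] ce_edges k) 2%N * v2
   + nth 0 (nth [::] ce_edges k) 3%N * v3 = 0.
  move=> k4; have := h (Ordinal k4); rewrite /weighted_sum !big_ord_recl big_ord0.
  by rewrite /ce_f /= !hgt_vec !crd_vec /= !addrA addr0.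
have [h0 h1] := (eqn 0%N isT, eqn 1%N isT); have [h2 h3] := (eqn 2%N isT, eqn 3%N isT).
rewrite /= in h0 h1 h2 h3.
have v01 : v0 = - v1.
  apply/eqP; rewrite -addr_eq0; apply/eqP.
  by have := congr2 (fun u u' => u - u') h0 h1; rewrite subrr => e; rewrite -[RHS]e; ncring.
have tE : t = - (c * v3) by apply/eqP; rewrite -addr_eq0 -[X in _ == X]h2 v01; apply/eqP; ncring.
have v23 : v2 = - v3.
  apply: (mulrI (hD c0)); apply/eqP; rewrite mulrN -tE -subr_eq0 -oppr_eq0 -[X in _ == X]h3 v01.
  by apply/eqP; ncring.
have v1E : v1 = (c + a - 1) * v3.
  by apply/eqP; rewrite -subr_eq0 -[X in _ == X]h0 tE v23; apply/eqP; ncring.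
rewrite /ce_z quadZ v01 v1E v23 tE; congr quad; ncring.
Qed.

(** The difference of x_134 and x_234 is a multiple of e_1 - e_2, nonzero by [p0]. Removing e_1 -
    e_2 from x_124 and x_123 leaves e_4 and e_3; then x_1234 gives e_0 by [c0], and x_134 gives
    e_1. *)
Lemma ce_span W : right_subspace W -> W ce_z -> (forall l, W (ce_w l)) -> forall v, W v.
Proof.
move=> [W0 WD WZ] Wz Ww v.
have Ww0 := Ww (inord 0); have Ww1 := Ww (inord 1); have Ww2 := Ww (inord 2).
have {Ww} Ww3 := Ww (inord 3); rewrite /ce_w !inordK //= in Ww0 Ww1 Ww2 Ww3.
have pV : (1 + b - b * a) * (1 + b - b * a)^-1 = 1 by rewrite mulrV ?hD.
have Wd : W (quad 0 1 (-1) 0 0).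
  have -> : quad 0 1 (-1) 0 0
      = quad 0 (1 + b - b * a) (- (1 + b - b * a)) 0 0 *m ((1 + b - b * a)^-1)%:M.
    by rewrite quadZ mulNr pV !mul0r.
  apply: (WZ); have := WD _ _ Ww1 (WZ _ (-1) Ww0); rewrite quadZ quadD.
  by congr (W (quad _ _ _ _ _)); ncring.
have We3 : W (quad 0 0 0 0 1).
  have := WD _ _ Ww2 (WZ _ (-1) Wd); rewrite quadZ quadD.
  by congr (W (quad _ _ _ _ _)); ncring.
have We2 : W (quad 0 0 0 1 0).
  have := WD _ _ Ww3 (WZ _ (- a) Wd); rewrite quadZ quadD.
  by congr (W (quad _ _ _ _ _)); ncring.
have Wo : W (quad 1 0 0 0 0).
  have -> : quad 1 0 0 0 0 = quad (- c) 0 0 0 0 *m (- c^-1)%:M.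
    by rewrite quadZ mulrNN mulrV ?hD // !mul0r.
  apply: (WZ); have := WD _ _ (WD _ _ Wz (WZ _ (c + a - 1) Wd)) (WD _ _ We2 (WZ _ (-1) We3)).
  by rewrite /ce_z !quadZ !quadD; congr (W (quad _ _ _ _ _)); ncring.
have We0 : W (quad 0 1 0 0 0).
  have -> : quad 0 1 0 0 0 = quad 0 (1 + b - b * a) 0 0 0 *m ((1 + b - b * a)^-1)%:M.
    by rewrite quadZ pV !mul0r.
  apply: (WZ); have := WD _ _ (WD _ _ Ww1 (WZ _ (- (a * b - b * a)) Wo))
    (WD _ _ (WZ _ b We2) (WZ _ (- (b * a)) We3)).
  by rewrite !quadZ !quadD; congr (W (quad _ _ _ _ _)); ncring.
have We1 : W (quad 0 0 1 0 0).
  have := WD _ _ We0 (WZ _ (-1) Wd); rewrite quadZ quadD.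
  by congr (W (quad _ _ _ _ _)); ncring.
rewrite (quad_eta v).
have := WD _ _ (WZ _ (hgt v) Wo) (WD _ _ (WD _ _ (WZ _ (crd v (inord 0)) We0)
  (WZ _ (crd v (inord 1)) We1)) (WD _ _ (WZ _ (crd v (inord 2)) We2)
  (WZ _ (crd v (inord 3)) We3))).
by rewrite !quadZ !quadD; congr (W (quad _ _ _ _ _)); ncring.
Qed.

(** A relation between x_1, x_123, x_124, x_134 loses x_134 by its height, the only nonzero one.
    Then w_3 removes x_123, w_4 removes x_124, and x_1 alone cannot vanish. *)
Lemma counterexample_inconsistent : ~ B_consistent D M.
Proof.
have [x hx] := hypercube_exists hD hM ce_f_neq0 ce_w_sum ce_z_neq0.
have nf := hypercube_normal_form hD hM ce_f_neq0 ce_f_anti hx.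
have gx := hypercube_generic hD hM ce_f_diag ce_f_neq0 ce_f_anti ce_w_diag ce_w_sum ce_w_star
  ce_z_star ce_z_unique ce_span hx.
move=> /(_ x gx (hypercube_initial_B hD hM ce_f_neq0 ce_f_anti hx)) Bx.
have o4 : uniq [:: inord 0; inord 1; inord 2; inord 3 : 'I_4].
  by rewrite /= !inE !inord4_eq.
have x_compl l : x (finset.setC (V1 l)) = line (std_frame D M *m ce_w l) :> set _.
  by rewrite hx vertex_compl.
pose s := [:: vec 0 (unit_at (inord 0)); ce_w (inord 3); ce_w (inord 2); ce_w (inord 1)].
have [j|u [k uk]] := coplanar_relation hD (s := s) (nf_inj nf) (Bx _ _ _ _ o4).
  case: j => [[|[|[|[|//]]]] ?] /=.
  - by exists (x (V1 (inord 0))); [left; left; left|exact: nf_axis nf _].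
  - exists (x (finset.setU (V1 (inord 0)) (V2 (inord 1) (inord 2)))); first by left; left; right.
    by rewrite finset.setUA (@V3_compl _ _ _ (inord 3)) // x_compl.
  - exists (x (finset.setU (V1 (inord 0)) (V2 (inord 1) (inord 3)))); first by left; right.
    by rewrite finset.setUA (@V3_compl _ _ _ (inord 2)) ?x_compl //= !inE !inord4_eq.
  - exists (x (finset.setU (V1 (inord 0)) (V2 (inord 2) (inord 3)))); first by right.
    by rewrite finset.setUA (@V3_compl _ _ _ (inord 1)) ?x_compl //= !inE !inord4_eq.
rewrite !big_ord_recl big_ord0 /= /ce_w !inordK //= addr0; set u0 := u ord0.
set u1 := u _; set u2 := u _; set u3 := u _ => rel.
have u3_0 : u3 = 0.
  have : (a * b - b * a) * u3 = 0.
    by have := congr1 (@hgt D) rel; rewrite !coordE => e; rewrite -[RHS]e; ncring.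
  by case/(divring_mul_eq0 hD) => // /eqP; rewrite (negPf ab).
have crd_rel m : unit_at (inord 0) m * u0
    + (nth 0 [:: a; - a; 1; 0] m * u1 + nth 0 [:: 1; -1; 0; 1] m * u2) = 0.
  by have := congr1 (fun v => crd v m) rel; rewrite u3_0 !coordE mulr0 addr0.
have u1_0 : u1 = 0.
  have := crd_rel (inord 2); rewrite /unit_at inord4_eq // inordK //= => e.
  by rewrite -[RHS]e; ncring.
have u2_0 : u2 = 0.
  have := crd_rel (inord 3); rewrite /unit_at inord4_eq // inordK //= => e.
  by rewrite -[RHS]e; ncring.
have u0_0 : u0 = 0.
  have := crd_rel (inord 0); rewrite /unit_at inord4_eq // inordK //= u1_0 u2_0 => e.
  by rewrite -[RHS]e; ncring.
suff : u k = 0 by move=> uk0; rewrite uk0 eqxx in uk.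
by case: k uk => [[|[|[|[|//]]]] ?] _;
  [rewrite -[RHS]u0_0|rewrite -[RHS]u1_0|rewrite -[RHS]u2_0|rewrite -[RHS]u3_0];
  congr (u _); apply: val_inj.
Qed.

End Counterexample.

Theorem theorem3 (D : unitRingType) (M : nat)
    (hD : division_ring D) (hM : (4 <= M)%N) :
  B_consistent D M <-> commutative (@GRing.mul D).
Proof.
split=> [consistent a b|mulC x gx Bx]; last first.
  have [E [f nf]] := normal_form_exists hD gx Bx.
  exact: (comm_final_B hD nf mulC gx).
have [//|ab] := eqVneq (a * b) (b * a); move: consistent; apply: contraPP => _.
have a0 : a != 0 by apply: contraNneq ab => ->; rewrite mulr0 mul0r.
have b0 : b != 0 by apply: contraNneq ab => ->; rewrite mulr0 mul0r.
have bV : b^-1 * b = 1 by rewrite mulVr ?hD.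
have Vb : b * b^-1 = 1 by rewrite mulrV ?hD.
(* Otherwise a = b + 1, which commutes with b. *)
have c0 : b + 1 - a != 0.
  by apply: contraNneq ab => /subr0_eq <-; apply/eqP; ncring.
apply: (@counterexample_inconsistent D hD M hM a b^-1 (b + 1 - a)) => //.
- by rewrite mulrBl mulrDl Vb mul1r.
(* The entry factors as b^-1 f_34, a product of nonzero elements. *)
- have -> : 1 + b^-1 - b^-1 * a = b^-1 * (b + 1 - a) by rewrite mulrBr mulrDr bV mulr1.
  by rewrite (divring_mul_neq0 hD) ?invr_eq0.
apply: contraNneq ab => /subr0_eq abV; apply/eqP.
rewrite -[a in RHS]mulr1 -bV [a * (_ * _)]mulrA abV.
by rewrite !mulrA Vb mul1r.
Qed.
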